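(* There exists a $C^3$ function $f:[0,1]\to(0,1)$ with isolated fixed points, $f\ge 1/2$, and having $1/2$ as unique stable fixed point, and there exists $l_1>0$, such that for every $l>0$, the generalized reinforced random walk associated to $f$ with law $\mathbb{P}_{0,w_0}$, where $w_0^x=(1/2,l)$ for all $x\in\mathbb{Z}$, is recurrent if $l\ge l_1$ and transient if $l<l_1$.
   Context: A fixed point $p$ of $f$ is stable if $f'(p)\le 1$. Generalized reinforced random walk started at $(0,w_0)$, $w_0=(\alpha_0^x,l_0^x)_{x\in\mathbb{Z}}$, associated to $f$: $X_0=0$; for $x\in\mathbb{Z}$, $n\ge0$ let $L_n^x=\sum_{k=0}^{n-1}1_{\{X_k=x\}}$ and $\tilde\alpha_n^x=\frac{1}{l_0^x+L_n^x}\big(\alpha_0^xl_0^x+\sum_{k=0}^{n-1}1_{\{X_k=x,X_{k+1}=x+1\}}\big)$; given the past, if $X_n=x$ then $X_{n+1}=x+1$ with probability $f(\tilde\alpha_n^x)$ and $X_{n+1}=x-1$ otherwise. Recurrent: every site visited infinitely often; transient: $X_n\to\pm\infty$. *)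

(* Defs.v *)
From HB Require Import structures.
From mathcomp Require Import all_boot all_order all_algebra.
From mathcomp Require Import all_classical all_reals all_analysis.
Set Implicit Arguments. Unset Strict Implicit. Unset Printing Implicit Defensive.
Import Order.TTheory GRing.Theory Num.Theory.
Import numFieldNormedType.Exports.
Local Open Scope classical_set_scope.
Local Open Scope ring_scope.

Section Walk.
Variable R : realType.

Definition is_C3 (f : R -> R) : Prop :=
  (forall x, derivable f x 1) /\
  (forall x, derivable (derive1 f) x 1) /\
  (forall x, derivable (derive1 (derive1 f)) x 1) /\
  continuous (derive1 (derive1 (derive1 f))).

Definition in01 (x : R) : bool := (0 <= x) && (x <= 1).

Definition isolated_fixed_points (f : R -> R) : Prop :=
  forall p, in01 p -> f p = p ->
    exists2 e : R, 0 < e &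
      forall q, in01 q -> f q = q -> `|q - p| < e -> q = p.

Definition stable_fixed_point (f : R -> R) (p : R) : Prop :=
  in01 p /\ f p = p /\ derive1 f p <= 1.

Definition Loc (x : nat -> int) (n : nat) (y : int) : nat :=
  (\sum_(k < n) ((x k == y) : nat))%N.

Definition Up (x : nat -> int) (n : nat) (y : int) : nat :=
  (\sum_(k < n) (((x k == y) && (x k.+1 == (y + 1)%R)) : nat))%N.

(* w0 y = (alpha_0^y, l_0^y) ;  tilde alpha_n^y *)
Definition alpha_tilde (w0 : int -> R * R) (x : nat -> int) (n : nat) (y : int)
  : R :=
  ((w0 y).1 * (w0 y).2 + (Up x n y)%:R) / ((w0 y).2 + (Loc x n y)%:R).

Definition step_prob (f : R -> R) (w0 : int -> R * R) (x : nat -> int) (k : nat)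
  : R :=
  let p := f (alpha_tilde w0 x k (x k)) in
  if x k.+1 == x k + 1 then p
  else if x k.+1 == x k - 1 then 1 - p
  else 0.

Definition path_prob (f : R -> R) (w0 : int -> R * R) (x : nat -> int) (n : nat)
  : R :=
  if x 0%N == 0 then \prod_(k < n) step_prob f w0 x k else 0.

(* X (defined on a probability space) has the law P_{0,w0} of the generalized
   reinforced random walk associated to f: its finite-dimensional
   distributions are those of the walk (which determine the law). *)
Definition is_GRRW {d} {T : measurableType d} (P : probability T R)
  (f : R -> R) (w0 : int -> R * R) (X : nat -> T -> int) : Prop :=
  forall (n : nat) (x : nat -> int),
    measurable [set t | forall k, (k <= n)%N -> X k t = x k] /\
    P [set t | forall k, (k <= n)%N -> X k t = x k] = (path_prob f w0 x n)%:E.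

Definition recurrent_path (x : nat -> int) : Prop :=
  forall y : int, forall N : nat, exists2 n : nat, (N <= n)%N & x n = y.

Definition transient_path (x : nat -> int) : Prop :=
  (forall M : int, exists N : nat, forall n, (N <= n)%N -> M <= x n) \/
  (forall M : int, exists N : nat, forall n, (N <= n)%N -> x n <= M).

End Walk.

(* Main.v *)
(* The successive steps from one site form an urn: after u up-steps and v down-steps
   the next one is up with probability q(u, v) = f((l/2 + u)/(l + u + v)), and the
   urns of different sites are independent. Since f >= 1/2, the only relevant
   quantity is the total expected drift delta = E[sum (2 q - 1)] of one urn: the walk
   is recurrent if delta <= 1 and transient if delta > 1.

   To see this, count for a large level k the down-steps from k-1, k-2, ..., 0 made
   before k is reached. Each site below k is left upwards once more than its right
   neighbour is left downwards, so these counts form a Markov chain V_0 = 0, V_1, ...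
   with V_(j+1) = number of down-steps of a fresh urn before its (V_j + 1)-th up-step.
   The walk visits 0 infinitely often iff V_k -> oo in probability. The chain is
   stochastically monotone, hence either tight or null, and by the martingale property
   of ups - downs - drift its mean increment from m is 1 - (drift consumed before the
   (m+1)-th up-step), which tends to 1 - delta from above as m -> oo. If delta > 1,
   Foster's criterion gives tightness; if delta <= 1, tightness would force linear
   growth of E[V_k], although V_k / k -> 0 with bounded second moments.

   Finally f is chosen nondecreasing, equal to 1/2 up to 15/16, and at most 7/8 on
   [0, 1]. Then delta is nonincreasing in l, the set delta <= 1 is closed by lower
   semicontinuity, it contains l = 15 and avoids small l; l1 is its infimum. *)
Require Import Defs.
From HB Require Import structures.
From mathcomp Require Import all_boot all_order all_algebra.
From mathcomp Require Import ring lra zify.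
From mathcomp Require Import all_classical all_reals all_analysis.
Import Order.TTheory GRing.Theory Num.Theory.
Import numFieldNormedType.Exports.
Local Open Scope classical_set_scope.
Local Open Scope ring_scope.

(** * Exit expectations of a single urn *)

Section Urn.
Context {R : realType}.
Variable q : nat -> nat -> R.
Hypothesis q_ge : forall u v, 2^-1 <= q u v.
Hypothesis q_le : forall u v, q u v <= 7 / 8.

Definition avg (B : nat -> nat -> R) (u v : nat) : R :=
  q u v * B u.+1 v + (1 - q u v) * B u v.+1.

(** Expectation of [B] after [t] draws of the urn frozen once [m < u], as a finite recursion rather
    than an integral over urn histories. *)
Fixpoint stopE (m : nat) (B : nat -> nat -> R) (t u v : nat) : R :=
  if t is t'.+1 then
    if (m < u)%N then B u v else avg (stopE m B t') u v
  else B u v.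

(** The value 0 before exit makes the [t]-draw expectations nondecreasing in [t] for [phi >= 0], so
    that they converge once bounded. *)
Definition exitf (m : nat) (phi : nat -> R) (u v : nat) : R :=
  if (m < u)%N then phi v else 0.

(* Expectation of [phi] at the number of down-steps made when the urn, started with
   [u] up- and [v] down-steps, makes its [m.+1]-th up-step. *)
Definition exitE (m : nat) (phi : nat -> R) (u v : nat) : R :=
  limn (fun t => stopE m (exitf m phi) t u v).

(** Quadratic growth covers second moments and is preserved by the kernel ([K_tame]), so the kernel
    can be iterated. *)
Definition tame (phi : nat -> R) : Prop :=
  (forall v, 0 <= phi v) /\
  exists2 c : R, 0 <= c & forall v, phi v <= c * (v%:R + 1) ^+ 2.

Definition superharm (m : nat) (B : nat -> nat -> R) : Prop :=
  forall u v, (u <= m)%N -> avg B u v <= B u v.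

Lemma avg_le (B B' : nat -> nat -> R) u v :
  B u.+1 v <= B' u.+1 v -> B u v.+1 <= B' u v.+1 -> avg B u v <= avg B' u v.
Proof.
move=> h1 h2; rewrite /avg lerD// ler_wpM2l//.
  by have := q_ge u v; lra.
by have := q_le u v; lra.
Qed.

Lemma avg_ge0 (B : nat -> nat -> R) u v :
  0 <= B u.+1 v -> 0 <= B u v.+1 -> 0 <= avg B u v.
Proof.
move=> h1 h2; rewrite /avg addr_ge0// mulr_ge0//.
  by have := q_ge u v; lra.
by have := q_le u v; lra.
Qed.

Lemma stopE_exit m B t u v : (m < u)%N -> stopE m B t u v = B u v.
Proof. by case: t => //= t ->. Qed.

Lemma stopE_le m B B' t u v :
  (forall u' v', (v <= v')%N -> B u' v' <= B' u' v') ->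
  stopE m B t u v <= stopE m B' t u v.
Proof.
elim: t u v => [|t IH] u v h /=; first exact: h.
case: ifP => _; first exact: h.
by apply: avg_le; apply: IH => // u' v' /ltnW; exact: h.
Qed.

Lemma stopE_superharm m B t u v : superharm m B -> stopE m B t u v <= B u v.
Proof.
move=> hB; elim: t u v => //= t IH u v; case: ifPn => //.
rewrite -leqNgt => um; apply: le_trans (hB _ _ um).
exact: avg_le.
Qed.

Lemma stopE_lin m B B' (a b : R) t u v :
  stopE m (fun u v => a * B u v + b * B' u v) t u v =
  a * stopE m B t u v + b * stopE m B' t u v.
Proof.
elim: t u v => //= t IH u v; case: ifP => _ //.
by rewrite /avg !IH; ring.
Qed.

Lemma exitf_ge0 m phi u v : (forall v, 0 <= phi v) -> 0 <= exitf m phi u v.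
Proof. by move=> h; rewrite /exitf; case: ifP. Qed.

Lemma exit_nd m phi u v : (forall v, 0 <= phi v) ->
  nondecreasing_seq (fun t => stopE m (exitf m phi) t u v).
Proof.
move=> h; apply/nondecreasing_seqP => t.
elim: t u v => [|t IH] u v.
  rewrite /=; case: ifPn => // um; rewrite {1}/exitf (negbTE um).
  by apply: avg_ge0; exact: exitf_ge0.
rewrite [leRHS]/= [leLHS]/=; case: ifP => // _.
by apply: avg_le; exact: IH.
Qed.

(** Optional stopping for nonnegative supermartingales; the moment bounds below are choices of
    [B]. *)
Lemma stopE_le_super m phi B t u v :
  (forall u v, 0 <= B u v) -> superharm m B ->
  (forall u v, (m < u)%N -> phi v <= B u v) ->
  stopE m (exitf m phi) t u v <= B u v.
Proof.
move=> B0 sB hB; apply: le_trans (stopE_superharm m B t u v sB).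
apply: stopE_le => u' v' _; rewrite /exitf; case: ifP => // h.
exact: hB.
Qed.

Lemma tame_super m phi : tame phi -> exists B,
  [/\ forall u v, 0 <= B u v, superharm m B &
      forall u v, (m < u)%N -> phi v <= B u v].
Proof.
move=> [p0 [c c0 hc]].
(* Let [r = m.+1 - u] be the number of missing up-steps. A draw moves [v + 1 + r] by 1 up or down
   with nonpositive drift, so its square grows by at most 1 on average; [2 * r] falls by
   [2 * q u v >= 1] and pays for this. *)
exists (fun u v => c * ((v%:R + 1 + (m.+1 - u)%:R) ^+ 2 + 2 * (m.+1 - u)%:R)).
split.
- by move=> u v; rewrite mulr_ge0// addr_ge0// ?sqr_ge0// mulr_ge0.
- move=> u v um; rewrite /avg.
  have -> : (m.+1 - u)%N = (m.+1 - u.+1).+1 by lia.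
  set r := (m.+1 - u.+1)%N.
  have q1 := q_ge u v; have q2 := q_le u v.
  rewrite -[v.+1]addn1 -[r.+1]addn1 !natrD.
  have : 0 <= v%:R :> R by []. have : 0 <= r%:R :> R by [].
  move: (v%:R) (r%:R) (q u v) q1 q2 => {}v {}r p q1 q2 r0 v0.
  rewrite mulrCA [X in _ + X]mulrCA -mulrDr ler_wpM2l//.
  have : 0 <= (2 * p - 1) * (v + r) by apply: mulr_ge0; lra.
  lra.
- move=> u v um; have -> : (m.+1 - u)%N = 0%N by lia.
  by rewrite mulr0 !addr0.
Qed.

Lemma exitE_cvg m phi u v : tame phi ->
  stopE m (exitf m phi) t u v @[t --> \oo] --> exitE m phi u v.
Proof.
move=> tp; have [B [B0 sB hB]] := tame_super m phi tp.
apply: nondecreasing_is_cvgn; first by apply: exit_nd; case: tp.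
exists (B u v) => _ [t _ <-]; exact: stopE_le_super.
Qed.

Lemma exitE_ge m phi t u v : tame phi ->
  stopE m (exitf m phi) t u v <= exitE m phi u v.
Proof.
move=> tp.
apply: (@nondecreasing_cvgn_le R (fun t => stopE m (exitf m phi) t u v)).
  by apply: exit_nd; case: tp.
by apply/cvg_ex; eexists; exact: exitE_cvg.
Qed.

Lemma exitE_le m phi u v C : tame phi ->
  (forall t, stopE m (exitf m phi) t u v <= C) -> exitE m phi u v <= C.
Proof.
move=> tp h; apply: limr_le; last exact: nearW.
by apply/cvg_ex; eexists; exact: exitE_cvg.
Qed.

Lemma exitE_ge0 m phi u v : tame phi -> 0 <= exitE m phi u v.
Proof.
move=> tp; apply: le_trans (exitE_ge m phi 0 u v tp).
by apply: exitf_ge0; case: tp.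
Qed.

Lemma exitE_le_super m phi B u v : tame phi ->
  (forall u v, 0 <= B u v) -> superharm m B ->
  (forall u v, (m < u)%N -> phi v <= B u v) ->
  exitE m phi u v <= B u v.
Proof. by move=> *; apply: exitE_le => // t; exact: stopE_le_super. Qed.

Lemma exitE_exit m phi u v : (m < u)%N -> exitE m phi u v = phi v.
Proof.
move=> um; rewrite /exitE.
under [X in X @ _]eq_fun do rewrite (stopE_exit _ _ _ _ _ um) /exitf um.
exact: lim_cst.
Qed.

Lemma exitE_rec m phi u v : tame phi -> (u <= m)%N ->
  exitE m phi u v = avg (exitE m phi) u v.
Proof.
move=> tp um; apply: cvg_lim => //.
rewrite -[X in X @ _ --> _]/(fun t => stopE m (exitf m phi) t u v).
rewrite -cvg_shiftS /=.
rewrite ltnNge um /=.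
by apply: cvgD; apply: cvgM; try (exact: cvg_cst); exact: exitE_cvg.
Qed.

(** Down-counts never decrease, so only the values from [v] on matter; [level_sub] relies on this
    restricted comparison. *)
Lemma exitE_local m phi psi u v : tame phi -> tame psi ->
  (forall v', (v <= v')%N -> phi v' <= psi v') ->
  exitE m phi u v <= exitE m psi u v.
Proof.
move=> tp ts h; apply: exitE_le => // t; apply: le_trans (exitE_ge m psi t u v ts).
by apply: stopE_le => u' v' vv'; rewrite /exitf; case: ifP => // _; exact: h.
Qed.

Lemma tame_lin phi psi (a b : R) : 0 <= a -> 0 <= b -> tame phi -> tame psi ->
  tame (fun v => a * phi v + b * psi v).
Proof.
move=> a0 b0 [p0 [c c0 hc]] [s0 [d d0 hd]]; split.
  by move=> v; rewrite addr_ge0// mulr_ge0.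
exists (a * c + b * d); first by rewrite addr_ge0// mulr_ge0.
by move=> v; rewrite mulrDl -!mulrA lerD// ler_wpM2l.
Qed.

Lemma exitE_lin m phi psi (a b : R) u v : 0 <= a -> 0 <= b ->
  tame phi -> tame psi ->
  exitE m (fun v => a * phi v + b * psi v) u v =
  a * exitE m phi u v + b * exitE m psi u v.
Proof.
move=> a0 b0 tp ts; apply: cvg_lim => //.
have -> : (fun t => stopE m (exitf m (fun v => a * phi v + b * psi v)) t u v) =
  (fun t => a * stopE m (exitf m phi) t u v + b * stopE m (exitf m psi) t u v).
  apply/funext => t; rewrite -stopE_lin; congr stopE.
  apply/funext => u'; apply/funext => v'; rewrite /exitf.
  by case: ifP => // _; rewrite !mulr0 addr0.
by apply: cvgD; apply: cvgM; try (exact: cvg_cst); exact: exitE_cvg.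
Qed.

Definition unit_valued (phi : nat -> R) := forall v, 0 <= phi v <= 1.

Lemma unit_tame phi : unit_valued phi -> tame phi.
Proof.
move=> h; split; first by move=> v; case/andP: (h v).
exists 1 => // v; case/andP: (h v) => _ /le_trans; apply.
by rewrite mul1r exprn_ege1// lerDr.
Qed.

Lemma exitE_unit m phi u v : unit_valued phi -> 0 <= exitE m phi u v <= 1.
Proof.
move=> h; have tp := unit_tame phi h; rewrite exitE_ge0//=.
apply: (exitE_le_super m phi (fun _ _ => 1)) => //.
  by move=> ? ? _; rewrite /avg; lra.
by move=> ? v' _; case/andP: (h v').
Qed.

(* [2^-u (4/3)^(u+v)] is a supermartingale, so the walk exits exponentially fast. *)
Lemma survival_bound m (C : R) (D : nat -> nat -> nat -> R) : 0 <= C ->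
  (forall t u v, (m < u)%N -> D t u v <= 0) ->
  (forall u v, (u <= m)%N -> D 0%N u v <= C) ->
  (forall t u v, (u <= m)%N -> D t.+1 u v <= avg (D t) u v) ->
  forall t u v, D t u v <= C * 2 ^+ m / 2 ^+ u * (3 / 4) ^+ t.
Proof.
move=> C0 h0 hC hD.
have pos t u : 0 <= C * 2 ^+ m / 2 ^+ u * (3 / 4) ^+ t.
  have t0 : (0 : R) <= 3 / 4 by lra.
  by apply: mulr_ge0; [apply: divr_ge0; [apply: mulr_ge0|]|]; rewrite ?exprn_ge0.
elim=> [|t IH] u v.
  case: (ltnP m u) => um.
    exact: le_trans (h0 _ _ _ um) (pos _ _).
  apply: le_trans (hC _ _ um) _; rewrite expr0 mulr1 -mulrA ler_peMr//.
  by rewrite ler_pdivlMr ?exprn_gt0// mul1r ler_weXn2l// ler1n.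
case: (ltnP m u) => um.
  exact: le_trans (h0 _ _ _ um) (pos _ _).
apply: le_trans (hD _ _ _ um) _.
apply: (@le_trans _ _ (avg (fun u _ => C * 2 ^+ m / 2 ^+ u * (3 / 4) ^+ t) u v)).
  exact: avg_le.
rewrite /avg !exprS invfM.
have := pos t u.
set X := C * 2 ^+ m / _ * _ => X0.
have -> : C * 2 ^+ m * (2^-1 / 2 ^+ u) * (3 / 4) ^+ t = 2^-1 * X.
  by rewrite /X; ring.
have -> : C * 2 ^+ m / 2 ^+ u * (3 / 4 * (3 / 4) ^+ t) = 3 / 4 * X.
  by rewrite /X; ring.
have := ler_wpM2r X0 (q_ge u v); lra.
Qed.

Lemma geometric_small (r C e : R) : 0 <= r < 1 -> 0 < e ->
  exists t : nat, C * r ^+ t < e.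
Proof.
move=> /andP[r0 r1] e0; have : (geometric C r) x @[x --> \oo] --> (0 : R).
  by apply: cvg_geometric; rewrite ger0_norm.
move=> /cvgr_lt /(_ _ e0) [t _ h]; exists t; exact: (h t (leqnn t)).
Qed.

(** This is [survival_bound] for a family constant in [t], with [t] tending to infinity. *)
Lemma maximum_principle m (C : R) (D : nat -> nat -> R) :
  (forall u v, (m < u)%N -> D u v <= 0) ->
  (forall u v, (u <= m)%N -> D u v <= C) ->
  (forall u v, (u <= m)%N -> D u v <= avg D u v) ->
  forall u v, D u v <= 0.
Proof.
move=> h0 hC hD u v; rewrite leNgt; apply/negP => D0.
have [t ht] := geometric_small (3 / 4) (Num.max 0 C * 2 ^+ m / 2 ^+ u) (D u v)
  ltac:(lra) D0.
have C0 : 0 <= Num.max 0 C by rewrite le_max lexx.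
have hC' u' v' : (u' <= m)%N -> D u' v' <= Num.max 0 C.
  by move=> um; rewrite le_max hC// orbT.
have := survival_bound m (Num.max 0 C) (fun=> D) C0 (fun=> h0) hC' (fun=> hD) t u v.
by move=> /le_lt_trans/(_ ht); rewrite ltxx.
Qed.

(** No mass is lost: the defect [1 - exitE] is bounded, harmonic before exit and 0 after it. *)
Lemma exitE1 m u v : exitE m (fun=> 1) u v = 1.
Proof.
have un1 : unit_valued (fun=> 1) by move=> ?; rewrite ler01 lexx.
apply/eqP; rewrite eq_le; apply/andP; split.
  by case/andP: (exitE_unit m _ u v un1).
rewrite -subr_le0.
apply: (maximum_principle m 1 (fun u v => 1 - exitE m (fun=> 1) u v)).
- by move=> ? ? h; rewrite exitE_exit// subrr.
- move=> u' v' _; rewrite gerBl exitE_ge0//; exact: unit_tame.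
- move=> u' v' um; rewrite [in leLHS]exitE_rec//; last exact: unit_tame.
  by rewrite /avg; lra.
Qed.

Lemma tame_cst (c : R) : 0 <= c -> tame (fun=> c).
Proof.
move=> c0; split => //; exists c => // v.
by rewrite ler_peMr// exprn_ege1// lerDr.
Qed.

Lemma exitE_cst m (c : R) u v : 0 <= c -> exitE m (fun=> c) u v = c.
Proof.
move=> c0; rewrite [X in exitE m X](_ : _ = (fun=> c * 1 + 0 * 1)); last first.
  by apply/funext => ?; rewrite mulr1 mul0r addr0.
by rewrite exitE_lin// ?exitE1; [lra| exact: tame_cst..].
Qed.

Lemma exitE_ge_cst m phi c u v : tame phi -> 0 <= c ->
  (forall v', (v <= v')%N -> c <= phi v') -> c <= exitE m phi u v.
Proof.
move=> tp c0 h; rewrite -(exitE_cst m c u v c0).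
by apply: exitE_local => //; exact: tame_cst.
Qed.

Lemma exitE_le_cst m phi c u v : tame phi -> 0 <= c ->
  (forall v', (v <= v')%N -> phi v' <= c) -> exitE m phi u v <= c.
Proof.
move=> tp c0 h; rewrite -(exitE_cst m c u v c0).
by apply: exitE_local => //; exact: tame_cst.
Qed.

Definition noninc (phi : nat -> R) := forall v, phi v.+1 <= phi v.

Lemma nonincP (phi : nat -> R) v v' : noninc phi -> (v <= v')%N -> phi v' <= phi v.
Proof.
move=> h; elim: v' => [|v' IH]; first by rewrite leqn0 => /eqP ->.
by rewrite leq_eqVlt => /orP[/eqP -> //|]; rewrite ltnS => /IH; exact: le_trans.
Qed.

(* Monotonicity in the level [m], i.e. stochastic monotonicity of the kernel. *)
Lemma exitE_noninc m phi u v : tame phi -> noninc phi ->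
  exitE m.+1 phi u v <= exitE m phi u v.
Proof.
move=> tp np; apply: exitE_le_super => //.
- by move=> *; exact: exitE_ge0.
- move=> u' v'; rewrite leq_eqVlt => /orP[/eqP ->|].
    (* Only [u' = m.+1] is new: the urn of level [m] has already stopped there, and the inequality
       is the monotonicity of [phi]. *)
    rewrite /avg !exitE_exit//; have := np v'; have := q_le m.+1 v' => h1 h2.
    have : 0 <= (1 - q m.+1 v') * (phi v' - phi v'.+1).
      by rewrite mulr_ge0// ?subr_ge0//; lra.
    lra.
  by rewrite ltnS => h; rewrite -exitE_rec.
- by move=> u' v' h; rewrite exitE_exit// ltnW.
Qed.

(* [delta t u v] is the expected drift accumulated in [t] steps from [(u, v)]. *)
Fixpoint delta (t u v : nat) : R :=
  if t is t'.+1 then (2 * q u v - 1) + avg (delta t') u v else 0.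

(* Transition kernel of the chain [V]. *)
Definition K (phi : nat -> R) (m : nat) : R := exitE m phi 0 0.

(** * Test functions and moment bounds for the kernel *)

Definition idR (v : nat) : R := v%:R.
Definition sqR (v : nat) : R := v%:R ^+ 2.
Definition geoR (v : nat) : R := 2^-1 ^+ v.

Lemma tame_sq : tame sqR.
Proof.
split; first by move=> v; rewrite sqr_ge0.
by exists 1 => // v; rewrite mul1r /sqR lerXn2r ?nnegrE ?addr_ge0// lerDl.
Qed.

Lemma tame_id : tame idR.
Proof.
split; first by move=> v; exact: ler0n.
exists 1 => // v; rewrite mul1r /idR; have : 0 <= v%:R :> R by []. nra.
Qed.

Lemma tame_geo : tame geoR.
Proof.
apply: unit_tame => v; rewrite exprn_ge0//= exprn_ile1//; lra.
Qed.

Lemma exitE_id_ge m u v : v%:R <= exitE m idR u v.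
Proof.
apply: exitE_ge_cst => //; first exact: tame_id.
by move=> v' ?; rewrite /idR ler_nat.
Qed.

(** Each draw changes [v - u] on average by minus its drift. The condition [u + t <= m.+1] rules out
    exit before the [t]-th draw, so the whole of [delta t u v] is consumed. *)
Lemma exitE_id_le m t u v : (u + t <= m.+1)%N ->
  exitE m idR u v <= v%:R + (m.+1 - u)%:R - delta t u v.
Proof.
elim: t u v => [|t IH] u v h.
  rewrite subr0; apply: (exitE_le_super m idR (fun u v => v%:R + (m.+1 - u)%:R)).
  - exact: tame_id.
  - by move=> *; exact: addr_ge0.
  - move=> u' v' um; rewrite /avg.
    have -> : (m.+1 - u')%N = (m.+1 - u'.+1).+1 by lia.
    by rewrite -![_.+1%:R]natr1; have := q_ge u' v'; lra.
  - by move=> u' v' um; rewrite /idR lerDl.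
rewrite exitE_rec; [|exact: tame_id|lia].
have -> : (m.+1 - u)%N = (m.+1 - u.+1).+1 by lia.
apply: (@le_trans _ _ (avg (fun u v => v%:R + (m.+1 - u)%:R - delta t u v) u v)).
  apply: avg_le; apply: IH; lia.
rewrite /= /avg.
have -> : (m.+1 - u)%N = (m.+1 - u.+1).+1 by lia.
by rewrite -!natr1; lra.
Qed.

Lemma delta_ge0 t u v : 0 <= delta t u v.
Proof.
elim: t u v => //= t IH u v; apply: addr_ge0; last exact: avg_ge0.
by have := q_ge u v; lra.
Qed.

Lemma K_id_le m : K idR m <= m%:R + 1.
Proof.
have := exitE_id_le m 0 0 0 (leq0n _).
by rewrite subn0 /= subr0 add0r -natr1.
Qed.

Lemma K_id_delta m t : (t <= m.+1)%N -> K idR m <= m%:R + 1 - delta t 0 0.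
Proof. by move=> h; have := exitE_id_le m t 0 0 h; rewrite subn0 -natr1 add0r. Qed.

(** The drift consumed before exit is at most the total drift. The error [D] of the martingale
    identity after [t] draws is at most 0 past exit and at most [m.+1] at [t = 0], so
    [survival_bound] makes it vanish. *)
Lemma K_id_ge m : (forall t, delta t 0 0 <= 1) -> m%:R <= K idR m.
Proof.
move=> hd; rewrite leNgt; apply/negP => lt.
have [t ht] := geometric_small (3 / 4) (m.+1%:R * 2 ^+ m / 2 ^+ 0) (m%:R - K idR m)
  ltac:(lra) ltac:(lra).
pose D t u v : R := v%:R + m.+1%:R - u%:R - delta t u v - exitE m idR u v.
have sb : D t 0%N 0%N <= m.+1%:R * 2 ^+ m / 2 ^+ 0 * (3 / 4) ^+ t.
  apply: (survival_bound m m.+1%:R D) => //.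
  - move=> t' u v um; rewrite /D exitE_exit// /idR; have := delta_ge0 t' u v.
    have : m.+1%:R <= u%:R :> R by rewrite ler_nat.
    lra.
  - move=> u v um; rewrite /D /=; have := exitE_id_ge m u v.
    have : 0 <= u%:R :> R by [].
    lra.
  - move=> t' u v um; rewrite /D /= [in leLHS]exitE_rec//; last exact: tame_id.
    by rewrite /avg -![_.+1%:R]natr1; lra.
have := le_lt_trans sb ht; rewrite /D -/(K idR m) -[m.+1%:R]natr1.
by have := hd t; lra.
Qed.

(** The first draw is down with probability at least 1/8. This strict increment at 0 drives the
    growth of the mean in [chain_null]. *)
Lemma K_id0_ge : 8^-1 <= K idR 0.
Proof.
rewrite /K exitE_rec//; last exact: tame_id.
rewrite /avg exitE_exit// /idR mulr0 add0r.
have := exitE_id_ge 0 0 1; have := q_le 0 0; nra.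
Qed.

(** The supermartingale of [tame_super] without the shift by 1; at the start it equals
    [(m + 1) ^ 2 + 2 * (m + 1)]. *)
Lemma K_sq_le m : K sqR m <= m%:R ^+ 2 + 4 * m%:R + 3.
Proof.
pose B u v : R := (v%:R + (m.+1 - u)%:R) ^+ 2 + 2 * (m.+1 - u)%:R.
have -> : m%:R ^+ 2 + 4 * m%:R + 3 = B 0%N 0%N.
  by rewrite /B subn0 -natr1; ring.
apply: exitE_le_super; first exact: tame_sq.
- by move=> u v; rewrite /B addr_ge0// ?sqr_ge0// mulr_ge0.
- move=> u v um; rewrite /avg /B.
  have -> : (m.+1 - u)%N = (m.+1 - u.+1).+1 by lia.
  set r := (m.+1 - u.+1)%N.
  have : 0 <= (2 * q u v - 1) * (v%:R + r%:R).
    by apply: mulr_ge0; [have := q_ge u v; lra|exact: addr_ge0].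
  have := q_ge u v.
  rewrite -[v.+1]addn1 -[r.+1]addn1 !natrD.
  by move: (v%:R) (r%:R) (q u v) => x y p; lra.
- move=> u v um; rewrite /B /sqR; have -> : (m.+1 - u = 0)%N by lia.
  by rewrite addr0 mulr0 addr0.
Qed.

(** [14/15] solves [x = 7/8 + 1/8 * x / 2]: it is the generating function at 1/2 of the down-steps
    before one up-step, in the extreme case [q = 7/8]. *)
Lemma K_geo_le m : K geoR m <= (14 / 15) ^+ m.+1.
Proof.
pose B u v : R := 2^-1 ^+ v * (14 / 15) ^+ (m.+1 - u).
have -> : (14 / 15) ^+ m.+1 = B 0%N 0%N :> R by rewrite /B subn0 mul1r.
apply: exitE_le_super; first exact: tame_geo.
- by move=> u v; rewrite /B mulr_ge0// exprn_ge0//; lra.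
- move=> u v um; rewrite /avg /B.
  have -> : (m.+1 - u)%N = (m.+1 - u.+1).+1 by lia.
  rewrite !exprS; set X := 2^-1 ^+ v; set Y := _ ^+ (m.+1 - u.+1).
  have : 0 <= (7 / 8 - q u v) * (X * Y).
    apply: mulr_ge0; first by have := q_le u v; lra.
    by apply: mulr_ge0; apply: exprn_ge0; lra.
  move: X Y => X Y; lra.
- move=> u v um; rewrite /B /geoR; have -> : (m.+1 - u = 0)%N by lia.
  by rewrite mulr1.
Qed.

(** * The Markov chain of down-step counts *)

Lemma K_mono phi psi : tame phi -> tame psi -> (forall v, phi v <= psi v) ->
  forall m, K phi m <= K psi m.
Proof. by move=> tp ts h m; exact: exitE_local. Qed.

Lemma K_lin phi psi (a b : R) : 0 <= a -> 0 <= b -> tame phi -> tame psi ->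
  K (fun v => a * phi v + b * psi v) = (fun m => a * K phi m + b * K psi m).
Proof. by move=> *; apply/funext => m; exact: exitE_lin. Qed.

Lemma K_cst (c : R) : 0 <= c -> K (fun=> c) = fun=> c.
Proof. by move=> c0; apply/funext => m; exact: exitE_cst. Qed.

Lemma K_tame phi : tame phi -> tame (K phi).
Proof.
move=> tp; have [p0 [c c0 hc]] := tp; split; first by move=> m; exact: exitE_ge0.
exists (8 * c) => [|m]; first lra.
have t1 : tame (fun=> 1 : R) by exact: tame_cst.
have c20 : 0 <= 2 * c by lra.
apply: (@le_trans _ _ (K (fun v => (2 * c) * sqR v + (2 * c) * 1) m)).
  apply: K_mono => //; first by apply: tame_lin => //; exact: tame_sq.
  move=> v; apply: le_trans (hc v) _; rewrite /sqR.
  have : 0 <= c * (v%:R - 1) ^+ 2 by rewrite mulr_ge0// sqr_ge0.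
  lra.
rewrite K_lin//; last exact: tame_sq.
rewrite K_cst//; have := ler_wpM2l c20 (K_sq_le m).
have : 0 <= c * m%:R by rewrite mulr_ge0.
have : 0 <= c * m%:R ^+ 2 by rewrite mulr_ge0// sqr_ge0.
lra.
Qed.

Lemma iterK_tame k phi : tame phi -> tame (iter k K phi).
Proof. by move=> tp; elim: k => //= k IH; exact: K_tame. Qed.

Lemma iterK_mono k phi psi : tame phi -> tame psi -> (forall v, phi v <= psi v) ->
  forall m, iter k K phi m <= iter k K psi m.
Proof.
by move=> tp ts h; elim: k => //= k IH; apply: K_mono => //; exact: iterK_tame.
Qed.

Lemma iterK_lin k phi psi (a b : R) : 0 <= a -> 0 <= b -> tame phi -> tame psi ->
  iter k K (fun v => a * phi v + b * psi v) =
  (fun m => a * iter k K phi m + b * iter k K psi m).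
Proof.
by move=> a0 b0 tp ts; elim: k => //= k ->; apply: K_lin => //; exact: iterK_tame.
Qed.

Lemma iterK_cst k (c : R) : 0 <= c -> iter k K (fun=> c) = fun=> c.
Proof. by move=> c0; elim: k => //= k ->; exact: K_cst. Qed.

Lemma K_unit phi : unit_valued phi -> unit_valued (K phi).
Proof. by move=> h m; exact: exitE_unit. Qed.

Lemma K_noninc phi : tame phi -> noninc phi -> noninc (K phi).
Proof. by move=> *; move=> m; exact: exitE_noninc. Qed.

Definition vanishing (phi : nat -> R) :=
  forall e : R, 0 < e -> exists M : nat, forall v, (M <= v)%N -> phi v <= e.

(** From a high state the chain rarely falls low: states below [M] are dominated by [2 ^+ M * geoR],
    whose expectation is exponentially small by [K_geo_le]. *)
Lemma K_vanishing phi : unit_valued phi -> vanishing phi -> vanishing (K phi).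
Proof.
move=> up vp e e0; have [M hM] := vp (e / 2) ltac:(lra).
have [t ht] := geometric_small (14 / 15) (2 ^+ M) (e / 2) ltac:(lra) ltac:(lra).
exists t => m tm.
have t1 : tame (fun=> 1 : R) by exact: tame_cst.
have e20 : 0 <= e / 2 by lra.
have M20 : 0 <= 2 ^+ M :> R by exact: exprn_ge0.
apply: (@le_trans _ _ (K (fun v => (e / 2) * 1 + 2 ^+ M * geoR v) m)).
  apply: K_mono; [exact: unit_tame| by apply: tame_lin => //; exact: tame_geo|].
  move=> v; have [Mv|vM] := leqP M v.
    by apply: le_trans (hM _ Mv) _; rewrite mulr1 lerDl mulr_ge0// exprn_ge0.
  have /andP[_ /le_trans->//] := up v.
  apply: (@le_trans _ _ (2 ^+ M * geoR v)); last by rewrite lerDr mulr1.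
  rewrite /geoR exprVn -expfB//.
  by rewrite exprn_ege1// ler1n.
rewrite K_lin//; last exact: tame_geo.
rewrite K_cst// mulr1.
have : 2 ^+ M * K geoR m <= 2 ^+ M * (14 / 15) ^+ t.
  rewrite ler_wpM2l//; apply: le_trans (K_geo_le m) _.
  by apply: ler_wiXn2l; [lra..|exact: leqW].
lra.
Qed.

Definition upto (M v : nat) : R := (v <= M)%N%:R.

(* [chainP k M] is the probability that the [k]-th term of the Markov chain with
   kernel [K] started at 0 is at most [M]. *)
Definition chainP (k M : nat) : R := iter k K (upto M) 0%N.

Lemma upto_unit M : unit_valued (upto M).
Proof. by move=> v; rewrite /upto ler0n lern1 leq_b1. Qed.

Lemma upto_noninc M : noninc (upto M).
Proof. by move=> v; rewrite /upto ler_nat; case: (leqP v.+1 M) => // /ltnW ->. Qed.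

Lemma upto_vanishing M : vanishing (upto M).
Proof. by move=> e e0; exists M.+1 => v; rewrite /upto ltnNge => /negbTE ->; exact: ltW. Qed.

Lemma iterK_upto k M : [/\ unit_valued (iter k K (upto M)),
  noninc (iter k K (upto M)) & vanishing (iter k K (upto M))].
Proof.
elim: k => [|k [IH1 IH2 IH3]] /=.
  by split; [exact: upto_unit|exact: upto_noninc|exact: upto_vanishing].
split; [exact: K_unit| |exact: K_vanishing].
by apply: K_noninc => //; exact: unit_tame.
Qed.

Lemma chainP_unit k M : 0 <= chainP k M <= 1.
Proof. by have [h _ _] := iterK_upto k M; exact: h. Qed.

(** The first step leads from 0 to a state at least 0, and a higher start can only lower the
    probability. *)
Lemma chainPS k M : chainP k.+1 M <= chainP k M.
Proof.
have [u n _] := iterK_upto k M; rewrite /chainP iterS.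
apply: exitE_le_cst; first exact: unit_tame.
  by case/andP: (u 0%N).
by move=> v _; exact: nonincP.
Qed.

Lemma chainP_le k j M : (k <= j)%N -> chainP j M <= chainP k M.
Proof. by move=> kj; apply: (nonincP (chainP ^~ M)) => // i; exact: chainPS. Qed.

(* The limit law of the chain is a subprobability, of mass [s] say. Restarting the
   chain from its state at a large time [k] and using monotonicity in the starting
   point gives [a <= a * s] for the limit [a] of [chainP k M0], so [s = 1] if [a > 0]. *)
Lemma chain_zero_one (M0 : nat) (c : R) : 0 < c ->
  (forall k, c <= chainP k M0) ->
  forall e : R, 0 < e -> exists M, forall j, 1 - e <= chainP j M.
Proof.
move=> c0 hc e e0.
pose S := range (chainP ^~ M0); pose a := inf S.
have hS : has_inf S.
  by split; [exists (chainP 0 M0), 0%N|exists c => _ [k _ <-]].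
have aP k : a <= chainP k M0 by apply: ge_inf; [exact: hS.2|exists k].
have ca : c <= a.
  apply: lb_le_inf; first exact: hS.1.
  by move=> _ [k _ <-].
have eta0 : 0 < a * e / 2 by rewrite divr_gt0// mulr_gt0//; exact: lt_le_trans ca.
have [_ [k _ <-] hk] := inf_adherent eta0 hS.
have [u n van] := iterK_upto k M0.
have [M hM] := van _ eta0; exists M => j.
rewrite leNgt; apply/negP => lt.
(* Markov property at time [j]: states up to [M] are replaced by 0, the most favourable start, and
   states above [M] contribute at most [a * e / 2]. *)
have : chainP (j + k) M0 <= chainP k M0 * chainP j M + a * e / 2.
  rewrite /chainP iterD.
  set psi := iter k K (upto M0) in u n hM *.
  have p0 : 0 <= psi 0%N by case/andP: (u 0%N).
  have t1 : tame (fun=> 1 : R) by exact: tame_cst.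
  have tM : tame (upto M) by apply: unit_tame; exact: upto_unit.
  apply: (@le_trans _ _ (iter j K (fun v => psi 0%N * upto M v + (a * e / 2) * 1) 0%N)).
    apply: iterK_mono; [exact: unit_tame|by apply: tame_lin => //; exact: ltW|].
    move=> v; rewrite mulr1 /upto; have [vM|Mv] := leqP v M.
      by rewrite mulr1 (le_trans (nonincP _ _ _ n (leq0n v)))// lerDl ltW.
    by rewrite mulr0 add0r hM// ltnW.
  rewrite iterK_lin//; last exact: ltW.
  by rewrite iterK_cst// mulr1.
have := aP (j + k)%N; move: hk; rewrite -/a => hk h1 h2.
have [p0 _] := andP (chainP_unit j M).
have h3 : a <= (a + a * e / 2) * chainP j M + a * e / 2.
  apply: le_trans h1 (le_trans h2 _); rewrite lerD2r ler_wpM2r// ltW//.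
have a0 : 0 < a by exact: lt_le_trans ca.
have : (a + a * e / 2) * chainP j M < (a + a * e / 2) * (1 - e).
  by rewrite ltr_pM2l//; lra.
have : 0 <= a * (e * e) by rewrite !mulr_ge0// ltW.
lra.
Qed.

Definition meanE (k : nat) : R := iter k K idR 0%N.

Lemma meanE_ge0 k : 0 <= meanE k.
Proof. by have [h _] := iterK_tame k idR tame_id; exact: h. Qed.

Lemma meanE_le k : meanE k <= k%:R.
Proof.
elim: k => [|k IH]; first by [].
rewrite /meanE iterSr; have t1 : tame (fun=> 1 : R) by exact: tame_cst.
apply: (@le_trans _ _ (iter k K (fun v => 1 * idR v + 1 * 1) 0%N)).
  apply: iterK_mono; first by apply: K_tame; exact: tame_id.
    by apply: tame_lin => //; exact: tame_id.
  by move=> v; rewrite !mul1r; exact: K_id_le.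
rewrite iterK_lin//; last exact: tame_id.
by rewrite iterK_cst// !mul1r -natr1 lerD2r.
Qed.

Lemma second_moment k : iter k K sqR 0%N <= 2 * k%:R ^+ 2 + k%:R.
Proof.
elim: k => [|k IH]; first by rewrite /= /sqR expr0n mulr0 addr0.
rewrite iterSr; have t1 : tame (fun=> 1 : R) by exact: tame_cst.
have ti := tame_id; have tsq := tame_sq.
have t43 : tame (fun v => 4 * idR v + 3 * 1) by exact: tame_lin.
apply: (@le_trans _ _ (iter k K (fun v => 1 * sqR v + 1 * (4 * idR v + 3 * 1)) 0%N)).
  apply: iterK_mono; [exact: K_tame|exact: tame_lin|].
  by move=> v; rewrite !mul1r mulr1 addrA; exact: K_sq_le.
rewrite iterK_lin// iterK_lin// iterK_cst//.
by have := meanE_le k; rewrite /meanE -natr1; lra.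
Qed.

(** Above [t] the mean falls by at least [e0], elsewhere it rises by at most 1. If the probability
    of being at most [t] fell below [c], it would stay there by [chainP_le], and the mean would lose
    [e0 / 2] per step and become negative. *)
Lemma chain_tight : (exists t, 1 < delta t 0 0) ->
  forall e : R, 0 < e -> exists M, forall j, 1 - e <= chainP j M.
Proof.
move=> [t ht]; set e0 := delta t 0 0 - 1; have e00 : 0 < e0 by rewrite /e0; lra.
have step j : meanE j.+1 + e0 <= meanE j + (1 + e0) * chainP j t.
  have t1 : tame (fun=> 1 : R) by exact: tame_cst.
  have ti := tame_id; have tki := K_tame _ ti.
  have tl : tame (upto t) by apply: unit_tame; exact: upto_unit.
  have e0' : 0 <= e0 by exact: ltW.
  have e1' : 0 <= 1 + e0 by lra.
  have : iter j K (fun v => 1 * K idR v + e0 * 1) 0%N <=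
         iter j K (fun v => 1 * idR v + (1 + e0) * upto t v) 0%N.
    apply: iterK_mono; [exact: tame_lin..|] => v; rewrite /upto /idR.
    case: leqP => h; first by rewrite !mulr1; have := K_id_le v; lra.
    rewrite mulr0; have := K_id_delta v t ltac:(lia); rewrite -/e0.
    have : delta t 0 0 = e0 + 1 by rewrite /e0; lra.
    lra.
  by rewrite !iterK_lin// iterK_cst// !mul1r mulr1 -iterSr.
pose c := e0 / (2 * (1 + e0)).
have c0 : 0 < c by rewrite divr_gt0//; lra.
have ce : (1 + e0) * c = e0 / 2 by rewrite /c; field; lra.
apply: (chain_zero_one t c) => // k; rewrite leNgt; apply/negP => lt.
have desc j : meanE (k + j) <= meanE k - j%:R * (e0 / 2).
  elim: j => [|j IH]; first by rewrite addn0 mul0r subr0.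
  rewrite addnS; have := step (k + j)%N.
  have : (1 + e0) * chainP (k + j) t <= (1 + e0) * c.
    rewrite ler_wpM2l//; first lra.
    by apply: le_trans (ltW lt); apply: chainP_le; exact: leq_addr.
  rewrite -[j.+1%:R]natr1; lra.
have [j hj] : exists j : nat, meanE k / (e0 / 2) < j%:R.
  exists (Num.bound (meanE k / (e0 / 2))).
  by apply: le_lt_trans (archi_boundP _) => //; rewrite divr_ge0 ?meanE_ge0//; lra.
have := desc j; have := meanE_ge0 (k + j); move: hj.
rewrite ltr_pdivrMr; last lra.
lra.
Qed.

(** All missing draws may be up-steps, each with probability at least 1/2. *)
Lemma exitE_upto0 m u : (2^-1) ^+ (m.+1 - u) <= exitE m (upto 0) u 0.
Proof.
have tl : tame (upto 0) by apply: unit_tame; exact: upto_unit.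
have [n] := ubnP (m.+1 - u); elim: n u => // n IH u hn.
have [um|mu] := leqP u m; last first.
  by rewrite exitE_exit// (_ : (m.+1 - u = 0)%N) ?expr0 /upto//=; lia.
rewrite exitE_rec// /avg (_ : (m.+1 - u)%N = (m.+1 - u.+1).+1); last lia.
rewrite exprS; have := IH u.+1 ltac:(lia).
have : (0 : R) <= (2^-1) ^+ (m.+1 - u.+1) by apply: exprn_ge0; lra.
have := exitE_ge0 m (upto 0) u 1 tl.
have := q_ge u 0; have := q_le u 0.
move: (q u 0) (exitE m (upto 0) u 1) (exitE m (upto 0) u.+1 0) => p x y.
set z := _ ^+ _ => h1 h2 x0 z0 zy.
have : 0 <= (1 - p) * x by rewrite mulr_ge0//; lra.
have : 0 <= (p - 2^-1) * y by rewrite mulr_ge0//; lra.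
lra.
Qed.

(* If the chain were tight, its mean would grow linearly (the drift is nonnegative,
   and positive at 0), although the chain divided by [k] tends to 0 and has bounded
   second moment. *)
Lemma chain_null : (forall t, delta t 0 0 <= 1) ->
  forall M (e : R), 0 < e -> exists k, chainP k M < e.
Proof.
move=> hd M0 e e0; apply: contrapT => /forallNP nk.
have he k : e <= chainP k M0 by rewrite leNgt; apply/negP; exact: nk.
have tight := chain_zero_one M0 e e0 he.
have t1 : tame (fun=> 1 : R) by exact: tame_cst.
have ti := tame_id; have tsq := tame_sq.
have tl M : tame (upto M) by apply: unit_tame; exact: upto_unit.
pose b : R := 2^-1 ^+ M0.+1 * e.
have b0 : 0 < b by rewrite mulr_gt0// exprn_gt0//; lra.
(* The chain is at most [M0] with probability at least [e], and from there it jumps to 0 with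
   probability at least [2^-1 ^+ M0.+1]. *)
have chain0 k : b <= chainP k.+1 0.
  rewrite /chainP iterSr.
  have p20 : (0 : R) <= 2^-1 ^+ M0.+1 by apply: exprn_ge0; lra.
  apply: (@le_trans _ _ (iter k K (fun v => 2^-1 ^+ M0.+1 * upto M0 v + 0 * 1) 0%N)).
    by rewrite iterK_lin// mul0r addr0 ler_wpM2l//; exact: he.
  apply: iterK_mono; [exact: tame_lin|exact: K_tame|].
  move=> v; rewrite mul0r addr0 /upto; have [vM|_] := leqP v M0; last first.
    by rewrite mulr0; have [h _] := K_tame _ (tl 0%N); exact: h.
  rewrite mulr1; apply: le_trans (exitE_upto0 v 0); rewrite subn0.
  by apply: ler_wiXn2l; [lra..|].
have grow k : meanE k + 8^-1 * chainP k 0 <= meanE k.+1.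
  have : iter k K (fun v => 1 * idR v + 8^-1 * upto 0 v) 0%N <= iter k K (K idR) 0%N.
    have p8 : (0 : R) <= 8^-1 by lra.
    apply: iterK_mono; [exact: tame_lin|exact: K_tame|].
    move=> [|v]; first by have := K_id0_ge; rewrite /idR /upto mulr0 add0r mulr1.
    by rewrite /upto /idR ltn0 mulr0 addr0 mul1r; exact: K_id_ge.
  by rewrite iterK_lin// mul1r -iterSr.
pose g := b / 8; have g0 : 0 < g by rewrite /g; lra.
have low k : k%:R * g <= meanE k.+1.
  elim: k => [|k IH]; first by rewrite mul0r; exact: meanE_ge0.
  have := grow k.+1; have := chain0 k; rewrite -[k.+1%:R]natr1 /g.
  by move: IH; rewrite /g; lra.
(* [C * n] is the truncation point: beyond it the second moment, at most [3 * n ^ 2], contributes at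
   most [3 * n / C = n * g / 4]. *)
pose C := 12 / g; have C0 : 0 < C by rewrite divr_gt0.
have Cg : C * g = 12 by rewrite /C; field; lra.
have [M hM] := tight (g / (4 * C)) ltac:(by rewrite divr_gt0// mulr_gt0).
have up n : (0 < n)%N -> meanE n <= M%:R + n%:R * (g / 4) + n%:R * (g / 4).
  move=> n0; have n0' : (0 : R) < n%:R by rewrite ltr0n.
  have Cn : 0 < C * n%:R by rewrite mulr_gt0.
  have p1 : 0 <= M%:R + C * n%:R by rewrite addr_ge0// ltW.
  have p2 : 0 <= (C * n%:R)^-1 by rewrite invr_ge0 ltW.
  (* For [v > M] this reads [v <= C * n + v ^ 2 / (C * n)]; by tightness the term [C * n] is paid
     with probability at most [g / (4 * C)]. *)
  have : iter n K (fun v => 1 * idR v + (C * n%:R) * upto M v) 0%N <=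
    iter n K (fun v => (M%:R + C * n%:R) * 1 + (C * n%:R)^-1 * sqR v) 0%N.
    apply: iterK_mono; [by apply: tame_lin => //; exact: ltW|exact: tame_lin|].
    move=> v; rewrite mul1r mulr1 /idR /sqR /upto; have [vM|_] := leqP v M.
      have : v%:R <= M%:R :> R by rewrite ler_nat.
      have : 0 <= (C * n%:R)^-1 * v%:R ^+ 2 by rewrite mulr_ge0// sqr_ge0.
      by rewrite mulr1; lra.
    rewrite mulr0.
    have : 0 <= (C * n%:R)^-1 * (v%:R - C * n%:R) ^+ 2 by rewrite mulr_ge0// sqr_ge0.
    have -> : (C * n%:R)^-1 * (v%:R - C * n%:R) ^+ 2 =
      (C * n%:R)^-1 * v%:R ^+ 2 - 2 * v%:R + C * n%:R.
      by field; rewrite !lt0r_neq0.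
    have : 0 <= M%:R :> R by [].
    have : 0 <= v%:R :> R by [].
    lra.
  rewrite !iterK_lin//; last exact: ltW.
  rewrite iterK_cst// mul1r mulr1 -/(meanE n) -/(chainP n M) => h.
  have h1 : C * n%:R * (1 - g / (4 * C)) <= C * n%:R * chainP n M.
    by rewrite ler_wpM2l//; exact: ltW.
  have h2 : C * n%:R * (1 - g / (4 * C)) = C * n%:R - n%:R * (g / 4).
    by field; lra.
  have h3 := ler_wpM2l p2 (second_moment n).
  have h4 : (C * n%:R)^-1 * (2 * n%:R ^+ 2 + n%:R) <= n%:R * (g / 4).
    have -> : g = 12 / C by rewrite -Cg; field; lra.
    rewrite (_ : (C * n%:R)^-1 * _ = (2 * n%:R + 1) / C); last first.
      by field; rewrite !lt0r_neq0.
    rewrite (_ : n%:R * _ = (3 * n%:R) / C); last by field; lra.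
    apply: ler_wpM2r; first by rewrite invr_ge0 ltW.
    have : 1 <= n%:R :> R by rewrite ler1n.
    lra.
  lra.
pose n := Num.bound (2 * (M%:R + g) / g).
have hn : 2 * (M%:R + g) / g < n%:R.
  apply: le_lt_trans (archi_boundP _) => //.
  by rewrite divr_ge0 ?mulr_ge0// ?addr_ge0// ltW.
have := up n.+1 isT; have := low n; move: hn; rewrite ltr_pdivrMr// -[n.+1%:R]natr1.
lra.
Qed.

End Urn.

(** * The function f and the threshold *)

Section ReinforcementFunction.
Context {R : realType}.

Definition ppart (x : R) : R := Num.max 0 x.

Lemma ppart_ge0 x : 0 <= ppart x.
Proof. by rewrite /ppart le_max lexx. Qed.

Lemma ppart_id x : 0 <= x -> ppart x = x.
Proof. by move=> x0; rewrite /ppart max_r. Qed.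

Lemma ppart_eq0 x : x <= 0 -> ppart x = 0.
Proof. by move=> x0; rewrite /ppart max_l. Qed.

Lemma ppart_le x y : x <= y -> ppart x <= ppart y.
Proof. by move=> xy; rewrite /ppart ge_max le_max lexx /= le_max xy orbT. Qed.

(** A remainder bound uniform in [x] gives the derivative of the square across the kink at 0 without
    separate one-sided limits. *)
Lemma ppart_taylor x h : `|ppart (x + h) ^+ 2 - ppart x ^+ 2 - 2 * ppart x * h| <= h ^+ 2.
Proof.
rewrite ler_norml; case: (leP 0 x) => hx; case: (leP 0 (x + h)) => hy;
  rewrite ?(ppart_id _ hx) ?(ppart_id _ hy) ?(ppart_eq0 _ (ltW hx)) ?(ppart_eq0 _ (ltW hy));
  apply/andP; split; nra.
Qed.

Lemma is_derive_ppart2 (x : R) :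
  is_derive x 1 (fun y => ppart y ^+ 2) (2 * ppart x).
Proof.
have H : h^-1 *: (((fun y => ppart y ^+ 2) \o shift x) (h *: (1 : R)) - ppart x ^+ 2)
    @[h --> (0 : R)^'] --> (2 * ppart x : R).
  apply/cvgrPdist_le => e e0; near=> h.
  have h0 : h != 0 by near: h; exact: nbhs_dnbhs_neq.
  have he : `|h| <= e.
    near: h; apply: dnbhs0_le => //.
  rewrite /= /GRing.scale /= mulr1 distrC.
  have -> : h^-1 * (ppart (h + x) ^+ 2 - ppart x ^+ 2) - 2 * ppart x =
    h^-1 * (ppart (x + h) ^+ 2 - ppart x ^+ 2 - 2 * ppart x * h).
    by rewrite (addrC h); field.
  rewrite normrM normfV ler_pdivrMl ?normr_gt0//.
  apply: le_trans (ppart_taylor x h) _.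
  by rewrite -real_normK ?num_real// expr2 ler_wpM2l.
apply: DeriveDef; first by apply/cvg_ex; exists (2 * ppart x); exact: H.
exact: cvg_lim.
Unshelve. all: by end_near.
Qed.

(** In this form the product rule derives the higher powers from the square. *)
Lemma ppart3E : (fun y : R => ppart y ^+ 3) = (fun y => y * ppart y ^+ 2).
Proof.
apply/funext => y; case: (leP 0 y) => hy; first by rewrite ppart_id// -exprS.
by rewrite ppart_eq0 ?ltW// !expr0n mulr0.
Qed.

Lemma ppart4E : (fun y : R => ppart y ^+ 4) = (fun y => y * ppart y ^+ 3).
Proof.
apply/funext => y; case: (leP 0 y) => hy; first by rewrite ppart_id// -exprS.
by rewrite ppart_eq0 ?ltW// !expr0n mulr0.
Qed.

Lemma is_derive_idM (g : R -> R) (x dg : R) :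
  is_derive x 1 g dg -> is_derive x 1 (fun y => y * g y) (g x + x * dg).
Proof.
move=> hg; have h := is_deriveM (is_derive_id x (1 : R)) hg.
by apply: is_derive_eq h _; rewrite /GRing.scale /= mulr1 addrC.
Qed.

Lemma is_derive_ppart3 (x : R) :
  is_derive x 1 (fun y => ppart y ^+ 3) (3 * ppart x ^+ 2).
Proof.
rewrite ppart3E; apply: is_derive_eq (is_derive_idM _ _ _ (is_derive_ppart2 x)) _.
case: (leP 0 x) => hx; first by rewrite ppart_id//; ring.
by rewrite ppart_eq0 ?ltW//; ring.
Qed.

Lemma is_derive_ppart4 (x : R) :
  is_derive x 1 (fun y => ppart y ^+ 4) (4 * ppart x ^+ 3).
Proof.
rewrite ppart4E; apply: is_derive_eq (is_derive_idM _ _ _ (is_derive_ppart3 x)) _.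
case: (leP 0 x) => hx; first by rewrite ppart_id//; ring.
by rewrite ppart_eq0 ?ltW//; ring.
Qed.

(* On [0, 1] the drift [2 f - 1] is at most 3/4 and is nonzero only above 15/16, where
   an urn of drift 3/4 would rarely stay; near 1 it exceeds 5/8. *)
Definition fR (x : R) : R := 2^-1 + 3 / 8 * ppart (16 * x - 15) ^+ 4.

Lemma is_derive_affine (a b : R) (g : R -> R) (x dg : R) :
  is_derive (16 * x - 15) 1 g dg ->
  is_derive x 1 (fun y => a + b * g (16 * y - 15)) (b * (dg * 16)).
Proof.
move=> hg.
have hs : is_derive x 1 (fun y : R => 16 * y - 15) 16.
  have h := is_deriveB (is_deriveZ (16 : R) (is_derive_id x (1 : R)))
    (is_derive_cst (15 : R) x 1).
  by apply: is_derive_eq h _; rewrite subr0 /GRing.scale /= mulr1.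
have h1 := @is_derive1_comp R g (fun y => 16 * y - 15) x dg 16 hg hs.
have h2 := is_deriveD (is_derive_cst a x 1) (is_deriveZ b h1).
by apply: is_derive_eq h2 _; rewrite add0r.
Qed.

Lemma derive1_eq (g dg : R -> R) : (forall x : R, is_derive x 1 g (dg x)) ->
  (forall x : R, derivable g x 1) /\ derive1 g = dg.
Proof.
move=> h; split=> [x|]; first by have [] := h x.
by apply/funext => x; rewrite derive1E; have [] := h x.
Qed.

Lemma fR_derive : (forall x : R, derivable fR x 1) /\
  derive1 fR = (fun x => 0 + 3 / 8 * 4 * 16 * ppart (16 * x - 15) ^+ 3).
Proof.
apply: derive1_eq => x.
apply: is_derive_eq (is_derive_affine _ _ _ _ _ (is_derive_ppart4 _)) _; ring.
Qed.

Lemma ppart_continuous : continuous ppart.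
Proof.
move=> x; rewrite /ppart.
apply: (@continuous_max R _ (fun=> 0) id); first exact: cst_continuous.
exact: cvg_id.
Qed.

Lemma fR_C3 : is_C3 fR.
Proof.
have [d0 e0] := fR_derive.
have [d1 e1] := derive1_eq (derive1 fR)
  (fun x => 0 + 3 / 8 * 4 * 16 * 3 * 16 * ppart (16 * x - 15) ^+ 2)
  ltac:(by rewrite e0 => x; apply: is_derive_eq
    (is_derive_affine _ _ _ _ _ (is_derive_ppart3 _)) _; ring).
have [d2 e2] := derive1_eq (derive1 (derive1 fR))
  (fun x => 3 / 8 * 4 * 16 * 3 * 16 * 2 * 16 * ppart (16 * x - 15))
  ltac:(by rewrite e1 => x; apply: is_derive_eq
    (is_derive_affine _ _ _ _ _ (is_derive_ppart2 _)) _; ring).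
split; [exact: d0|split; [exact: d1|split; [exact: d2|]]].
rewrite e2 => x; apply: cvgM; first exact: cvg_cst.
apply: continuous_cvg; first exact: ppart_continuous.
by apply: cvgB; [apply: cvgM; [exact: cvg_cst|exact: cvg_id]|exact: cvg_cst].
Qed.

Lemma fR_continuous : continuous fR.
Proof.
by move=> x; apply/differentiable_continuous/derivable1_diffP; exact: fR_derive.1.
Qed.

Lemma fR_ge x : 2^-1 <= fR x.
Proof. by rewrite /fR lerDl mulr_ge0// exprn_ge0// ppart_ge0. Qed.

Lemma fR_half x : x <= 15 / 16 -> fR x = 2^-1.
Proof. move=> hx; rewrite /fR ppart_eq0 ?expr0n ?mulr0 ?addr0//; lra. Qed.

Lemma fR_le x y : x <= y -> fR x <= fR y.
Proof.
move=> xy; rewrite /fR lerD2l ler_wpM2l// lerXn2r ?nnegrE ?ppart_ge0//.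
by apply: ppart_le; lra.
Qed.

Lemma fR_1 : fR 1 = 7 / 8.
Proof.
rewrite /fR; have -> : 16 * 1 - 15 = 1 :> R by lra.
rewrite ppart_id ?expr1n; lra.
Qed.

Lemma fR_le78 x : x <= 1 -> fR x <= 7 / 8.
Proof. by rewrite -fR_1; exact: fR_le. Qed.

(** Up to 15/16 the function is constantly 1/2; beyond, [fR x <= 7/8 < x]. *)
Lemma fR_fixed x : in01 x -> fR x = x -> x = 2^-1.
Proof.
move=> /andP[x0 x1]; case: (leP x (15 / 16)) => hx; first by rewrite fR_half.
by have := fR_le78 x x1; lra.
Qed.

Lemma fR_fixed_half : fR 2^-1 = 2^-1.
Proof. by rewrite fR_half//; lra. Qed.

Lemma fR_spec :
  [/\ is_C3 fR, (forall x : R, in01 x -> 0 < fR x < 1),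
      isolated_fixed_points fR, (forall x : R, in01 x -> 2^-1 <= fR x) &
      stable_fixed_point fR 2^-1 /\
      forall p : R, stable_fixed_point fR p -> p = 2^-1].
Proof.
split.
- exact: fR_C3.
- move=> x /andP[_ x1]; have := fR_ge x; have := fR_le78 x x1; lra.
- move=> p p01 fp; exists 1 => // r r01 fr _.
  by rewrite (fR_fixed p)// (fR_fixed r).
- by move=> x _; exact: fR_ge.
- split; last by move=> p [p01 [fp _]]; exact: fR_fixed.
  split; first by rewrite /in01; lra.
  split; first exact: fR_fixed_half.
  by rewrite fR_derive.2 ppart_eq0 ?expr0n/= ?mulr0; lra.
Qed.

(** * The urns of the walk and the critical initial weight *)

Definition urn (l : R) (u v : nat) : R :=
  fR ((2^-1 * l + u%:R) / (l + (u + v)%N%:R)).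

Lemma urn_ge l u v : 2^-1 <= urn l u v.
Proof. exact: fR_ge. Qed.

Lemma urn_den (l : R) u v : 0 < l -> 0 < l + (u + v)%N%:R.
Proof. by move=> l0; rewrite ltr_pwDl. Qed.

Lemma urn_le l u v : 0 < l -> urn l u v <= 7 / 8.
Proof.
move=> l0; apply: fR_le78; rewrite ler_pdivrMr ?urn_den// mul1r natrD.
have : 0 <= v%:R :> R by []. lra.
Qed.

Lemma urn_swap l u v : 0 < l -> urn l u v.+1 <= urn l u.+1 v.
Proof.
move=> l0; apply: fR_le; rewrite addSnnS ler_wpM2r//.
  by rewrite invr_ge0 ltW// urn_den.
by rewrite lerD2l ler_nat.
Qed.

(** A larger initial weight pulls the proportion towards 1/2. This lowers it when [v <= u], which
    holds wherever [fR] exceeds 1/2. *)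
Lemma urn_antitone l l' u v : 0 < l -> l <= l' -> urn l' u v <= urn l u v.
Proof.
move=> l0 ll'; rewrite {1}/urn; set y := (X in fR X <= _).
case: (leP y (15 / 16)) => hy; first by rewrite fR_half// urn_ge.
have l'0 : 0 < l' by exact: lt_le_trans ll'.
have uv : v%:R <= u%:R :> R.
  move: hy; rewrite /y ltr_pdivlMr ?urn_den// natrD.
  have : 0 <= v%:R :> R by []. lra.
apply: fR_le; rewrite /y ler_pdivrMr ?urn_den// mulrAC ler_pdivlMr ?urn_den//.
rewrite natrD; have : 0 <= (l' - l) * (u%:R - v%:R) by rewrite mulr_ge0// subr_ge0.
lra.
Qed.

Lemma urn_continuous l u v : 0 < l -> {for l, continuous (fun l => urn l u v)}.
Proof.
move=> l0; rewrite /prop_for /continuous_at /urn.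
apply: continuous_cvg; first exact: fR_continuous.
apply: cvgM.
  by apply: cvgD; [apply: cvgM; [exact: cvg_cst|exact: cvg_id]|exact: cvg_cst].
apply: cvgV; first by rewrite lt0r_neq0// urn_den.
by apply: cvgD; [exact: cvg_id|exact: cvg_cst].
Qed.

Lemma delta_continuous l t u v : 0 < l ->
  {for l, continuous (fun l => delta (urn l) t u v)}.
Proof.
move=> l0; rewrite /prop_for /continuous_at.
elim: t u v => [|t IH] u v /=; first exact: cvg_cst.
have cu := urn_continuous l u v l0.
apply: cvgD; first by apply: cvgB; [apply: cvgM; [exact: cvg_cst|]|exact: cvg_cst].
apply: cvgD; (apply: cvgM; last exact: IH); first exact: cu.
by apply: cvgB; [exact: cvg_cst|exact: cu].
Qed.

(** Exchanging a down-step for an up-step raises the current up-probability; the induction chains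
    the successors [(u, v + 2)], [(u + 1, v + 1)] and [(u + 2, v)]. *)
Lemma delta_swap l t u v : 0 < l -> delta (urn l) t u v.+1 <= delta (urn l) t u.+1 v.
Proof.
move=> l0; elim: t u v => //= t IH u v.
apply: lerD; first by have := urn_swap l u v l0; lra.
rewrite /avg.
have h1 := IH u v.+1; have h2 := IH u.+1 v.
have := urn_ge l u v.+1; have := urn_le l u v.+1 l0.
have := urn_ge l u.+1 v; have := urn_le l u.+1 v l0.
move: h1 h2; set a := delta _ _ u v.+2; set b := delta _ _ u.+1 v.+1.
set c := delta _ _ u.+2 v; set p' := urn l u v.+1; set p := urn l u.+1 v.
move=> h1 h2 p1 p2 p3 p4.
have : 0 <= (1 - p') * (b - a) by rewrite mulr_ge0//; lra.
have : 0 <= p * (c - b) by rewrite mulr_ge0//; lra.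
lra.
Qed.

(* Raising [l] lowers every up-probability, and by [delta_swap] an up-step leaves
   more drift to come than a down-step. *)
Lemma delta_antitone l l' t u v : 0 < l -> l <= l' ->
  delta (urn l') t u v <= delta (urn l) t u v.
Proof.
move=> l0 ll'; have l'0 : 0 < l' by exact: lt_le_trans ll'.
elim: t u v => //= t IH u v.
have h := urn_antitone l l' u v l0 ll'.
apply: lerD; first lra.
apply: (@le_trans _ _ (avg (urn l') (delta (urn l) t) u v)).
  by apply: avg_le => //; [exact: urn_ge|move=> *; exact: urn_le].
rewrite /avg; have := delta_swap l t u v l0.
move: h; set b := delta _ _ u v.+1; set a := delta _ _ u.+1 v.
set p := urn l' u v; set p' := urn l u v => h1 h2.
have : 0 <= (p' - p) * (a - b) by rewrite mulr_ge0//; lra.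
lra.
Qed.

(** [W] is a potential that pays for the drift at each draw, so its initial value bounds the
    total. *)
Lemma delta_le_super (q W : nat -> nat -> R) t u v :
  (forall u v, 2^-1 <= q u v) -> (forall u v, q u v <= 7 / 8) ->
  (forall u v, 0 <= W u v) ->
  (forall u v, (2 * q u v - 1) + avg q W u v <= W u v) ->
  delta q t u v <= W u v.
Proof.
move=> q1 q2 W0 hW; elim: t u v => //= t IH u v.
by apply: le_trans (hW u v); rewrite lerD2l; exact: avg_le.
Qed.

(* [W] is at least 128 where the drift is nonzero, i.e. for [u > 105 + 15 v], since
   (21/20)^15 > 2; and [avg W <= (1 - 3/160) W]. *)
Lemma delta_large t : delta (urn 15) t 0 0 <= 1.
Proof.
pose W u v : R := (21 / 20) ^+ u * 2^-1 ^+ v.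
apply: (@le_trans _ _ (W 0%N 0%N)); last by rewrite /W mulr1.
have p15 : (0 : R) < 15 by [].
have a0 : (0 : R) <= 21 / 20 by lra.
apply: delta_le_super => [u v|u v|u v|u v]; [exact: urn_ge|exact: urn_le| |].
  by rewrite /W mulr_ge0// exprn_ge0//; lra.
have W0 : 0 <= W u v by rewrite /W mulr_ge0// exprn_ge0//; lra.
have -> : avg (urn 15) W u v = (urn 15 u v * (21 / 20) + (1 - urn 15 u v) / 2) * W u v.
  by rewrite /avg /W !exprS; ring.
rewrite {1 2 3}/urn; set y := (X in fR X).
case: (leP y (15 / 16)) => hy; first by rewrite fR_half//; lra.
have y1 : fR y <= 7 / 8 by exact: urn_le.
have y2 := fR_ge y.
suff : 128 <= W u v.
  have : 0 <= (7 / 8 - fR y) * W u v by rewrite mulr_ge0//; lra.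
  lra.
have uv : (105 + 15 * v <= u)%N.
  move: hy; rewrite /y ltr_pdivlMr ?urn_den// natrD => hy.
  suff : (105 + 15 * v)%N%:R <= u%:R :> R by rewrite ler_nat.
  rewrite natrD natrM; lra.
have e15 : 2 <= (21 / 20) ^+ 15 :> R by lra.
rewrite /W; apply: (@le_trans _ _ ((21 / 20) ^+ (105 + 15 * v) * 2^-1 ^+ v)).
  rewrite (_ : (105 + 15 * v = 15 * (7 + v))%N); last lia.
  rewrite exprM; apply: (@le_trans _ _ (2 ^+ (7 + v) * 2^-1 ^+ v)).
    by rewrite exprD -mulrA -exprMn mulfV// expr1n mulr1; lra.
  rewrite ler_wpM2r//.
  by apply: lerXn2r; [rewrite nnegrE; lra|exact: exprn_ge0|exact: e15].
rewrite ler_wpM2r//.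
by apply: ler_weXn2l => //; lra.
Qed.

(* An initial run of six up-steps already contributes more than 1. *)
Lemma delta_small l : 0 < l -> l <= 200^-1 -> 1 < delta (urn l) 6 0 0.
Proof.
move=> l0 l1.
(* With [l <= 200^-1], a run of up-steps only puts the proportion at 399/400 or more. *)
have hq n : 13 / 16 <= urn l n.+1 0.
  apply: (@le_trans _ _ (fR (399 / 400))).
    by rewrite /fR (_ : 16 * _ - 15 = 24 / 25 :> R) ?ppart_id; lra.
  apply: fR_le; rewrite ler_pdivlMr ?urn_den// addn0 -natr1.
  have : 0 <= n%:R :> R by []. lra.
(* [5/8 = 2 * 13/16 - 1] is the drift of this draw; the branch after a down-step is estimated by
   0. *)
have step t n (c : R) : 0 <= c -> c <= delta (urn l) t n.+2 0 ->
    5 / 8 + 13 / 16 * c <= delta (urn l) t.+1 n.+1 0.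
  move=> c0 hc; rewrite /= /avg; have h1 := hq n; have h2 := urn_le l n.+1 0 l0.
  have h3 : 0 <= delta (urn l) t n.+1 1.
    by apply: delta_ge0; [exact: urn_ge|move=> *; exact: urn_le].
  have : 0 <= (1 - urn l n.+1 0) * delta (urn l) t n.+1 1 by rewrite mulr_ge0//; lra.
  have : 0 <= (urn l n.+1 0 - 13 / 16) * c by rewrite mulr_ge0//; lra.
  have : 0 <= urn l n.+1 0 * (delta (urn l) t n.+2 0 - c) by rewrite mulr_ge0//; lra.
  lra.
have s1 n : 5 / 8 <= delta (urn l) 1 n.+1 0.
  by have := step 0%N n 0 (lexx _) (lexx _); lra.
have s2 n : 9 / 8 <= delta (urn l) 2 n.+1 0.
  by have := step 1%N n (5 / 8) ltac:(lra) (s1 _); lra.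
have s3 n : 3 / 2 <= delta (urn l) 3 n.+1 0.
  by have := step 2%N n (9 / 8) ltac:(lra) (s2 _); lra.
have s4 n : 9 / 5 <= delta (urn l) 4 n.+1 0.
  by have := step 3%N n (3 / 2) ltac:(lra) (s3 _); lra.
(* The very first draw is fair, so half of this value, [26/25], is what remains. *)
have s5 : 52 / 25 <= delta (urn l) 5 1 0.
  by have := step 4%N 0%N (9 / 5) ltac:(lra) (s4 _); lra.
have u0 : urn l 0 0 = 2^-1.
  rewrite /urn !addr0 (_ : _ / l = 2^-1) ?fR_fixed_half//.
  by rewrite mulfK// lt0r_neq0.
have h3 : 0 <= delta (urn l) 5 0 1.
  by apply: delta_ge0; [exact: urn_ge|move=> *; exact: urn_le].
rewrite -[delta _ 6 _ _]/((2 * urn l 0 0 - 1) + avg (urn l) (delta (urn l) 5) 0 0).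
rewrite /avg u0; move: s5 h3; set a := delta _ _ 1 0; set b := delta _ _ 0 1.
lra.
Qed.

Lemma drift_threshold : exists2 l1 : R, 0 < l1 & forall l, 0 < l ->
  (l1 <= l -> forall t, delta (urn l) t 0 0 <= 1) /\
  (l < l1 -> exists t, 1 < delta (urn l) t 0 0).
Proof.
pose S := [set l : R | 0 < l /\ forall t, delta (urn l) t 0 0 <= 1].
have S15 : S 15 by split => // t; exact: delta_large.
have lbS : lbound S 200^-1.
  move=> l [l0 hl]; rewrite leNgt; apply/negP => lt.
  by have := delta_small l l0 (ltW lt); rewrite ltNge hl.
have hS : has_inf S by split; [exists 15|exists 200^-1].
exists (inf S).
  by apply: lt_le_trans (lb_le_inf hS.1 lbS); lra.
move=> l l0; split => h.
  (* If [delta] exceeded 1 at [l], it would still do so at [l + e / 2] by continuity. But some [s]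
     in [S] lies below that point, contradicting antitonicity. *)
  move=> t; rewrite leNgt; apply/negP => gt1.
  have := delta_continuous l t 0 0 l0.
  move=> /cvgr_gt/(_ _ gt1)/nbhs_ballP[e /= e0 he].
  have hl : 1 < delta (urn (l + e / 2)) t 0 0.
    apply: he; rewrite /ball /= opprD addNKr normrN gtr0_norm; lra.
  have [s [s0 hs] sl] := inf_adherent (ltac:(lra) : 0 < e / 2) hS.
  have := delta_antitone s (l + e / 2) t 0 0 s0 ltac:(lra).
  by move=> /(lt_le_trans hl); rewrite ltNge hs.
apply: contrapT => /forallNP hn.
have : S l by split => // t; rewrite leNgt; apply/negP; exact: hn.
by move=> /(ge_inf hS.2); rewrite leNgt h.
Qed.

End ReinforcementFunction.

(** * Expectations of the walk *)

Section WalkExpectation.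
Context {R : realType}.
Variable q : nat -> nat -> R.
Hypothesis q_ge : forall u v, 2^-1 <= q u v.
Hypothesis q_le : forall u v, q u v <= 7 / 8.

(* A state records the numbers of up- and down-steps made so far from each site,
   and the current position. *)
Definition state : Type := ((int -> nat * nat) * int)%type.

Definition step (S : state) (b : bool) : state :=
  (fun y => if y == S.2 then
              (if b then ((S.1 y).1.+1, (S.1 y).2) else ((S.1 y).1, (S.1 y).2.+1))
            else S.1 y,
   if b then S.2 + 1 else S.2 - 1).

Definition start : state := (fun=> (0, 0)%N, 0).

Definition up_prob (S : state) : R := q (S.1 S.2).1 (S.1 S.2).2.

Definition stepE (Phi : state -> R) (S : state) : R :=
  up_prob S * Phi (step S true) + (1 - up_prob S) * Phi (step S false).

Fixpoint walkE (n : nat) (Phi : state -> R) (S : state) : R :=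
  if n is n'.+1 then stepE (walkE n' Phi) S else Phi S.

Lemma stepE_le Phi Psi S : Phi (step S true) <= Psi (step S true) ->
  Phi (step S false) <= Psi (step S false) -> stepE Phi S <= stepE Psi S.
Proof.
move=> h1 h2; rewrite /stepE /up_prob lerD// ler_wpM2l//.
  by have := q_ge (S.1 S.2).1 (S.1 S.2).2; lra.
by have := q_le (S.1 S.2).1 (S.1 S.2).2; lra.
Qed.

(** The invariant [I] and the horizon [N] serve [down_bounded], where the inequality is available
    only before a level is reached. *)
Lemma walkE_superharm (N : nat) (I : nat -> state -> Prop) (Phi : state -> R) :
  (forall i S b, I i S -> I i.+1 (step S b)) ->
  (forall i S, (i < N)%N -> I i S -> stepE Phi S <= Phi S) ->
  forall n i S, (i + n <= N)%N -> I i S -> walkE n Phi S <= Phi S.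
Proof.
move=> hI hPhi; elim=> [//|n IH] i S iN iS /=.
apply: (@le_trans _ _ (stepE Phi S)); last by apply: (hPhi i) => //; lia.
by apply: stepE_le; apply: (IH i.+1); [lia|exact: hI|lia|exact: hI].
Qed.

Lemma walkE_superharmT (Phi : state -> R) n S :
  (forall S, stepE Phi S <= Phi S) -> walkE n Phi S <= Phi S.
Proof.
move=> h; exact: (@walkE_superharm n (fun _ _ => True) Phi (fun _ _ _ _ => Logic.I)
  (fun _ S' _ _ => h S') n 0%N S (leqnn n) Logic.I).
Qed.

(** * Supermartingales of the walk *)

Lemma step_site S b y : y != S.2 -> (step S b).1 y = S.1 y.
Proof. by move=> /negbTE h; rewrite /step /= h. Qed.

(** [16/15] is the inverse of [7/8 + 1/8 * 1/2], the largest mean factor of the halving at each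
    down-step. Likewise [4/3] in [up_weight] is the inverse of [1/2 + 1/2 * 1/2], attained at
    [q = 1/2]. *)
Definition down_weight (y : int) (S : state) : R :=
  2^-1 ^+ (S.1 y).2 * (16 / 15) ^+ ((S.1 y).1 + (S.1 y).2).

Definition up_weight (y : int) (S : state) : R :=
  2^-1 ^+ (S.1 y).1 * (4 / 3) ^+ ((S.1 y).1 + (S.1 y).2).

Lemma down_weight_ge0 y S : 0 <= down_weight y S.
Proof. by rewrite mulr_ge0// exprn_ge0//; lra. Qed.

Lemma up_weight_ge0 y S : 0 <= up_weight y S.
Proof. by rewrite mulr_ge0// exprn_ge0//; lra. Qed.

Lemma down_weight_super y S : stepE (down_weight y) S <= down_weight y S.
Proof.
have W0 := down_weight_ge0 y S.
have [yS|yS] := eqVneq y S.2; last first.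
  by rewrite /stepE /down_weight !step_site//; lra.
rewrite /stepE /up_prob /down_weight /step /= !yS eqxx /= addSn addnS !exprS.
move: W0; rewrite /down_weight yS.
set a := 2^-1 ^+ _; set b := (16 / 15) ^+ _.
have := q_le (S.1 S.2).1 (S.1 S.2).2; set p := q _ _ => p1 W0.
have : 0 <= (7 / 8 - p) * (a * b) by rewrite mulr_ge0//; lra.
lra.
Qed.

Lemma up_weight_super y S : stepE (up_weight y) S <= up_weight y S.
Proof.
have W0 := up_weight_ge0 y S.
have [yS|yS] := eqVneq y S.2; last first.
  by rewrite /stepE /up_weight !step_site//; lra.
rewrite /stepE /up_prob /up_weight /step /= !yS eqxx /= addSn addnS !exprS.
move: W0; rewrite /up_weight yS.
set a := 2^-1 ^+ _; set b := (4 / 3) ^+ _.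
have := q_ge (S.1 S.2).1 (S.1 S.2).2; set p := q _ _ => p1 W0.
have : 0 <= (p - 2^-1) * (a * b) by rewrite mulr_ge0//; lra.
lra.
Qed.

(* Distance to the level [k], stopped when [k] is reached. *)
Definition left_gap (k : nat) (S : state) : R :=
  if (S.1 k%:Z == (0, 0)%N) && (S.2 < k%:Z) then (k%:Z - S.2)%:~R else 0.

Lemma left_gap_ge0 k S : 0 <= left_gap k S.
Proof.
rewrite /left_gap; case: ifP => // /andP[_ h].
by rewrite ler0z subr_ge0 ltW.
Qed.

Lemma left_gap_super k S : stepE (left_gap k) S <= left_gap k S.
Proof.
have [Sk|kS] := ltP S.2 k%:Z; last first.
  (* A step from [k] is recorded at [k], which keeps the gap at 0; a step from beyond [k] cannot
     land below it. *)
  have h b : left_gap k (step S b) = 0.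
    rewrite /left_gap; have [e|ne] := eqVneq k%:Z S.2.
      by rewrite /step /= e eqxx; case: b; rewrite xpair_eqE /= ?andbF.
    rewrite [X in _ && X](_ : _ = false) ?andbF//.
    by apply/negbTE; rewrite -leNgt /step /=; case: b => /=; lia.
  by rewrite /stepE !h !mulr0 addr0 left_gap_ge0.
have ne : k%:Z != S.2 by lia.
have [z|nz] := boolP (S.1 k%:Z == (0, 0)%N); last first.
  by rewrite /stepE /left_gap !step_site// (negbTE nz) /= !mulr0 addr0.
rewrite /stepE /left_gap !step_site// z Sk /=.
have -> : (S.2 - 1 < k%:Z) by lia.
have -> : (if S.2 + 1 < k%:Z then (k%:Z - (S.2 + 1))%:~R else 0) =
          (k%:Z - S.2)%:~R - 1 :> R.
  have [lt|ge] := ltP (S.2 + 1) k%:Z; first by rewrite opprD addrA [LHS]intrB.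
  have -> : k%:Z - S.2 = 1 by lia.
  by rewrite subrr.
have -> : (k%:Z - (S.2 - 1))%:~R = (k%:Z - S.2)%:~R + 1 :> R.
  by rewrite opprB addrCA addrC [LHS]intrD.
by have := q_ge (S.1 S.2).1 (S.1 S.2).2; rewrite /up_prob; lra.
Qed.

(* Given the steps recorded in [w], [level w phi k m] is the expectation of [phi] at
   the final number of down-steps from site 0, if [m] is that of site [k] and if
   each site between is left upwards one more time than its right neighbour is
   left downwards. *)
Fixpoint level (w : int -> nat * nat) (phi : nat -> R) (k : nat) : nat -> R :=
  if k is k'.+1 then
    fun m => exitE q m (level w phi k') (w k'%:Z).1 (w k'%:Z).2
  else phi.

Lemma levelS w phi k m : level w phi k.+1 m =
  exitE q m (level w phi k) (w k%:Z).1 (w k%:Z).2.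
Proof. by []. Qed.

Lemma level_start phi k : level start.1 phi k = iter k (K q) phi.
Proof. by elim: k => //= k ->. Qed.

Lemma level_unit w phi k : unit_valued phi -> unit_valued (level w phi k).
Proof. by move=> h; elim: k => //= k IH m; exact: exitE_unit. Qed.

Lemma level_noninc w phi k : unit_valued phi -> noninc phi ->
  noninc (level w phi k).
Proof.
move=> h n; elim: k => //= k IH m; apply: exitE_noninc => //.
by apply: unit_tame; exact: level_unit.
Qed.

Lemma level_local w w' phi k : (forall j, (j < k)%N -> w j%:Z = w' j%:Z) ->
  level w phi k = level w' phi k.
Proof.
elim: k => //= k IH h; rewrite IH; last by move=> j jk; apply: h; exact: leqW.
by rewrite h.
Qed.

Lemma level_step_lt S b phi k : (S.2 < 0) || (k%:Z <= S.2) ->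
  level (step S b).1 phi k = level S.1 phi k.
Proof.
move=> h; apply: level_local => j jk; apply: step_site.
by apply/eqP => e; move: h; rewrite -e; lia.
Qed.

(** After exit, too: surplus down-steps only lower a nonincreasing [phi]. So [level_super] holds at
    all times, also once [k] has been passed. *)
Lemma exitE_super m phi u v : unit_valued phi -> noninc phi ->
  q u v * exitE q m phi u.+1 v + (1 - q u v) * exitE q m phi u v.+1 <=
  exitE q m phi u v.
Proof.
move=> up np; have [um|mu] := leqP u m.
  by rewrite -/(avg q (exitE q m phi) u v) -exitE_rec//; exact: unit_tame.
rewrite !exitE_exit// ?leqW//; have := np v; have := q_le u v => h1 h2.
have : 0 <= (1 - q u v) * (phi v - phi v.+1) by rewrite mulr_ge0// ?subr_ge0//; lra.
lra.
Qed.

Lemma up_prob_bounds S : 0 <= up_prob S <= 1.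
Proof.
have := q_ge (S.1 S.2).1 (S.1 S.2).2; have := q_le (S.1 S.2).1 (S.1 S.2).2.
rewrite /up_prob; lra.
Qed.

Lemma exitE_mix S m phi psi u v : unit_valued phi -> unit_valued psi ->
  up_prob S * exitE q m phi u v + (1 - up_prob S) * exitE q m psi u v =
  exitE q m (fun j => up_prob S * phi j + (1 - up_prob S) * psi j) u v.
Proof.
move=> h1 h2; have /andP[p0 p1] := up_prob_bounds S.
by rewrite exitE_lin ?subr_ge0//; exact: unit_tame.
Qed.

Lemma mix_tame S phi psi : unit_valued phi -> unit_valued psi ->
  tame (fun j => up_prob S * phi j + (1 - up_prob S) * psi j).
Proof.
move=> h1 h2; have /andP[p0 p1] := up_prob_bounds S.
by apply: tame_lin; rewrite ?subr_ge0//; exact: unit_tame.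
Qed.

(** A step changes the record of one site only. There [exitE_super] applies, the sites below being
    unaffected; at any other site the average passes inside [exitE] by linearity. *)
Lemma level_super S phi k m : unit_valued phi -> noninc phi ->
  stepE (fun S => level S.1 phi k m) S <= level S.1 phi k m.
Proof.
move=> h n; rewrite /stepE; elim: k m => [|k IH] m.
  by rewrite /=; lra.
have ul S' := level_unit S'.1 phi k h.
have [e|ne] := eqVneq k%:Z S.2.
  rewrite !levelS !(level_step_lt _ _ _ k) -?e ?lexx ?orbT//.
  rewrite /step /= !e eqxx /= /up_prob; apply: exitE_super => //.
  exact: level_noninc.
rewrite !levelS !step_site// exitE_mix//.
apply: exitE_local => //; [exact: mix_tame|exact: unit_tame].
Qed.

(** Crossings of the edge between [y] and [y.+1] alternate, beginning upwards because the walk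
    starts at 0. *)
Definition balanced (S : state) : Prop :=
  forall y : nat, (S.1 y%:Z).1 = ((S.1 y.+1%:Z).2 + (y%:Z < S.2)%R)%N.

Definition early (i : nat) (S : state) : Prop :=
  [/\ S.2 <= i%:Z, forall y : nat, (i <= y)%N -> S.1 y%:Z = (0, 0)%N & balanced S].

Lemma early_start : early 0 start.
Proof. by split => // y; rewrite /= ltNge. Qed.

Lemma early_step i S b : early i S -> early i.+1 (step S b).
Proof.
move=> [h1 h2 h3]; split.
- by rewrite /step /=; case: b => /=; lia.
- move=> y iy; rewrite step_site; first by apply: h2; lia.
  by apply/eqP => e; move: h1; rewrite -e; lia.
- move=> y; have := h3 y; rewrite /step /=.
  have [e|ne] := eqVneq y%:Z S.2.
    have {}e : (y%:Z = S.2 :> int) := e.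
    have -> : (y.+1%:Z == S.2) = false by apply/negbTE; lia.
    rewrite -e ltxx; case: b => /= ->; first by rewrite (_ : y%:Z < _ = true)//; lia.
    by rewrite (_ : y%:Z < _ = false)//; lia.
  have [e'|ne'] := eqVneq y.+1%:Z S.2.
    have {}e' : (y.+1%:Z = S.2 :> int) := e'.
    have -> : y%:Z < S.2 by lia.
    case: b => /= ->; first by rewrite (_ : y%:Z < _ = true)//; lia.
    by rewrite (_ : y%:Z < _ = false)//; lia.
  by case: b => ->; congr (_ + _)%N; congr nat_of_bool; apply/idP/idP; lia.
Qed.

(* Before level [k] is reached, the one-step equation of [exitE] holds with
   equality: site [x] has been left upwards exactly as often as [x + 1] has been
   left downwards, so it has not yet used up its up-steps. *)
Lemma level_sub S phi k i : (i < k)%N -> early i S -> unit_valued phi ->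
  level S.1 phi k 0 <= stepE (fun S => level S.1 phi k 0) S.
Proof.
move=> ik [Si fresh bal] h; rewrite /stepE.
have [S0|S0] := ltP S.2 0.
  by rewrite !level_step_lt ?S0//; lra.
have [j ej] : exists j : nat, S.2 = j%:Z by exists `|S.2|%N; lia.
have uj : (S.1 j%:Z).1 = (S.1 j.+1%:Z).2 by rewrite bal ej ltxx addn0.
(* The urn at [j] must not have exited, a condition stated only for [d = 0]. The induction obtains
   it from [v' >= (S.1 j.+1).2 = (S.1 j).1], the range to which [exitE_local] restricts the
   comparison. *)
suff main d m : (d = 0%N -> ((S.1 j%:Z).1 <= m)%N) ->
    level S.1 phi (d + j.+1) m <= up_prob S * level (step S true).1 phi (d + j.+1) m
      + (1 - up_prob S) * level (step S false).1 phi (d + j.+1) m.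
  have := main (k - j.+1)%N 0%N; rewrite subnK; last by lia.
  apply => e; rewrite uj fresh//; lia.
elim: d m => [|d IH] m hm.
  rewrite add0n !levelS !(level_step_lt _ _ _ j) ?ej ?lexx ?orbT//.
  rewrite /step /= !ej eqxx /= /up_prob ej exitE_rec//; last exact: hm.
  by apply: unit_tame; exact: level_unit.
have ne : (d + j.+1)%N%:Z != S.2 by rewrite ej; lia.
have ul S' := level_unit S'.1 phi (d + j.+1) h.
rewrite addSn !levelS !step_site// exitE_mix//.
apply: exitE_local => //; [exact: unit_tame|exact: mix_tame|].
move=> v' hv; apply: IH => d0; move: hv; rewrite d0 add0n uj//.
Qed.

(** The final count at 0 is at least the recorded one. The index is [k.+1] because [level] reads
    site 0 only from the first level on. *)
Lemma level_zero (w : int -> nat * nat) M k m : (M < (w 0).2)%N -> level w (upto M) k.+1 m = 0.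
Proof.
move=> hM; have u0 k' := level_unit w (upto M) k' (upto_unit M).
apply/eqP; rewrite eq_le; apply/andP; split; last by case/andP: (u0 k.+1 m).
elim: k m => [|k IH] m.
  apply: exitE_le_cst => //; first by apply: unit_tame; exact: upto_unit.
  by move=> v' hv; rewrite /upto leqNgt (leq_trans hM hv).
rewrite levelS; apply: (exitE_le_cst _ q_ge q_le _ (level w (upto M) k.+1)) => //.
by apply: unit_tame; exact: u0.
Qed.

(** By balance, every site below [k] has one more up-step than its right neighbour has down-steps,
    so all exits have already occurred. Monotonicity replaces 0 by the actual down-count of [k]. *)
Lemma level_final S M k : balanced S -> k%:Z <= S.2 -> ((S.1 0).2 <= M)%N ->
  1 <= level S.1 (upto M) k 0.
Proof.
move=> bal kS hM.
have un := @upto_unit R M; have nn := @upto_noninc R M.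
apply: le_trans _ (nonincP _ _ _ (level_noninc S.1 (upto M) k un nn) (leq0n (S.1 k%:Z).2)).
elim: k kS => [|k IH] kS; first by rewrite /= /upto hM.
rewrite /= exitE_exit; first by apply: IH; lia.
by rewrite bal (_ : k%:Z < S.2) ?addn1//; lia.
Qed.

End WalkExpectation.

(** * Deterministic properties of paths *)

Section Paths.

Definition Down (x : nat -> int) (n : nat) (y : int) : nat :=
  (\sum_(k < n) ((x k == y) && (x k.+1 == (y - 1)%R)))%N.

Definition nearest_neighbor (x : nat -> int) (n : nat) : Prop :=
  x 0%N = 0 /\
  forall k, (k < n)%N -> exists b : bool, x k.+1 = if b then x k + 1 else x k - 1.

Definition path_state (x : nat -> int) (n : nat) : state :=
  (fun y => (Up x n y, Down x n y), x n).

Lemma path_state0 x : x 0%N = 0 -> path_state x 0 = start.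
Proof.
move=> x0; rewrite /path_state /start x0; congr pair.
by apply/funext => y; rewrite /Up /Down !big_ord0.
Qed.

Lemma path_stateS x n (b : bool) : x n.+1 = (if b then x n + 1 else x n - 1) ->
  path_state x n.+1 = step (path_state x n) b.
Proof.
move=> h; rewrite /path_state /step /= h; congr pair.
apply/funext => y; rewrite /Up /Down !big_ord_recr /= h [y == x n]eq_sym.
have [<-|_] := eqVneq (x n) y; last by rewrite !addn0.
have pm : (x n + 1 == x n - 1) = false by apply/negbTE; lia.
have mp : (x n - 1 == x n + 1) = false by apply/negbTE; lia.
by case: b h => _; rewrite /= !eqxx ?pm ?mp /= ?addn0 ?addn1.
Qed.

Lemma path_state_ext x x' n : (forall k, (k <= n)%N -> x k = x' k) ->
  path_state x n = path_state x' n.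
Proof.
move=> h; rewrite /path_state h//; congr pair; apply/funext => y.
by congr pair; apply: eq_bigr => k _; rewrite !h//; exact: ltnW.
Qed.

Lemma nearest_neighbor_ext x x' n : (forall k, (k <= n)%N -> x k = x' k) ->
  nearest_neighbor x n -> nearest_neighbor x' n.
Proof.
move=> h [x0 hs]; split; first by rewrite -h.
by move=> k kn; have [b hb] := hs k kn; exists b; rewrite -!h//; exact: ltnW.
Qed.

Lemma nearest_neighborW x m n : (m <= n)%N ->
  nearest_neighbor x n -> nearest_neighbor x m.
Proof. by move=> mn [x0 hs]; split => // k km; apply: hs; exact: leq_trans mn. Qed.

Lemma LocE x n y : nearest_neighbor x n -> Loc x n y = (Up x n y + Down x n y)%N.
Proof.
move=> [_ hs]; rewrite /Loc /Up /Down -big_split /=; apply: eq_bigr => k _.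
have [b ->] := hs k (ltn_ord k); have [<-|//] := eqVneq (x k) y.
have pm : (x k + 1 == x k - 1) = false by apply/negbTE; lia.
have mp : (x k - 1 == x k + 1) = false by apply/negbTE; lia.
by case: b; rewrite /= ?eqxx ?pm ?mp.
Qed.

Lemma path_state_early x n : nearest_neighbor x n -> early n (path_state x n).
Proof.
elim: n => [|n IH] h; first by rewrite path_state0 ?h.1//; exact: early_start.
have [b hb] := h.2 n (ltnSn n).
by rewrite (path_stateS x n b hb); apply: early_step; apply: IH; exact: nearest_neighborW h.
Qed.

Lemma UpS x n y : Up x n.+1 y = (Up x n y + ((x n == y) && (x n.+1 == (y + 1)%R)))%N.
Proof. by rewrite /Up big_ord_recr. Qed.

Lemma DownS x n y : Down x n.+1 y = (Down x n y + ((x n == y) && (x n.+1 == (y - 1)%R)))%N.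
Proof. by rewrite /Down big_ord_recr. Qed.

Lemma LocS x n y : Loc x n.+1 y = (Loc x n y + (x n == y))%N.
Proof. by rewrite /Loc big_ord_recr. Qed.

Definition unbounded (c : nat -> nat) : Prop := forall M, exists n, (M <= c n)%N.

Definition infinitely_often (x : nat -> int) (y : int) : Prop :=
  forall N : nat, exists2 n, (N <= n)%N & x n = y.

Lemma unbounded_io (c : nat -> nat) (A : nat -> Prop) : c 0%N = 0%N ->
  (forall n, (c n.+1 <= (c n).+1)%N) -> (forall n, ~ A n -> c n.+1 = c n) ->
  unbounded c -> forall N, exists2 n, (N <= n)%N & A n.
Proof.
move=> c0 c1 cA uc N; apply: contrapT => hN.
have hA n : (N <= n)%N -> ~ A n by move=> Nn An; apply: hN; exists n.
have cn n : (c n <= n)%N by elim: n => [|n IH]; [rewrite c0|exact: leq_trans (c1 n) _].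
have cN n : (c n <= N)%N.
  elim: n => [|n IH]; first by rewrite c0.
  have [nN|Nn] := ltnP n N; first by apply: leq_trans (cn n.+1) _.
  by rewrite cA//; exact: hA.
by have [n] := uc N.+1; rewrite ltnNge cN.
Qed.

Lemma io_Loc x y : infinitely_often x y -> unbounded (fun n => Loc x n y).
Proof.
move=> h; elim=> [|M [n hn]]; first by exists 0%N.
have [m nm xm] := h n; exists m.+1; rewrite LocS xm eqxx addn1 ltnS.
apply: leq_trans hn _; elim: m nm {xm} => [|m IH]; first by rewrite leqn0 => /eqP ->.
rewrite leq_eqVlt => /orP[/eqP ->//|]; rewrite ltnS => /IH /leq_trans; apply.
by rewrite LocS leq_addr.
Qed.

Lemma Up_io x y : unbounded (fun n => Up x n y) -> infinitely_often x (y + 1).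
Proof.
move=> h N.
have [|||n Nn [_ h2]] := unbounded_io (fun n => Up x n y)
  (fun n => x n = y /\ x n.+1 = y + 1) _ _ _ h N.
- by rewrite /Up big_ord0.
- by move=> n; rewrite UpS; case: (_ && _); rewrite ?addn1 ?addn0.
- move=> n hn; rewrite UpS; case: eqP => [e1|]; case: eqP => [e2|] //=; rewrite ?addn0//.
  by case: hn.
by exists n.+1 => //; exact: leqW.
Qed.

Lemma Down_io x y : unbounded (fun n => Down x n y) ->
  infinitely_often x y /\ infinitely_often x (y - 1).
Proof.
move=> h; suff H N : exists2 n, (N <= n)%N & x n = y /\ x n.+1 = y - 1.
  split=> N; have [n Nn [h1 h2]] := H N; first by exists n.
  by exists n.+1 => //; exact: leqW.
have [|||n Nn hn] := unbounded_io (fun n => Down x n y)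
  (fun n => x n = y /\ x n.+1 = y - 1) _ _ _ h N.
- by rewrite /Down big_ord0.
- by move=> n; rewrite DownS; case: (_ && _); rewrite ?addn1 ?addn0.
- move=> n hn; rewrite DownS; case: eqP => [e1|]; case: eqP => [e2|] //=; rewrite ?addn0//.
  by case: hn.
by exists n.
Qed.

(** Holds almost surely by [fair_as]; it passes infinitely many visits on to neighbours and so
    reduces recurrence to site 0. *)
Definition fair (x : nat -> int) : Prop :=
  (forall n, nearest_neighbor x n) /\
  forall y, infinitely_often x y ->
    unbounded (fun n => Up x n y) /\ unbounded (fun n => Down x n y).

Lemma fair_io x y z : fair x -> infinitely_often x y -> infinitely_often x z.
Proof.
move=> [_ hf] hy.
have up w (n : nat) : infinitely_often x w -> infinitely_often x (w + n%:Z).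
  elim: n => [|n IH] hw; first by rewrite addr0.
  have [hu _] := hf _ (IH hw).
  by rewrite -[n.+1]addn1 PoszD addrA; exact: Up_io.
have down w (n : nat) : infinitely_often x w -> infinitely_often x (w - n%:Z).
  elim: n => [|n IH] hw; first by rewrite subr0.
  have [_ hd] := hf _ (IH hw).
  by rewrite -[n.+1]addn1 PoszD opprD addrA; exact: (Down_io _ _ hd).2.
have [yz|zy] := leP y z.
  have -> : z = y + `|z - y|%N%:Z by lia.
  exact: up.
have -> : z = y - `|y - z|%N%:Z by lia.
exact: down.
Qed.

Lemma fair_recurrent x : fair x -> unbounded (fun n => Down x n 0) -> recurrent_path x.
Proof. by move=> hf /Down_io[h0 _] y; exact: fair_io h0. Qed.

(** No site is visited infinitely often, since otherwise 0 would be and would be left downwards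
    without bound. The walk finally keeps one sign and then abandons the levels one after
    another. *)
Lemma fair_dichotomy x : fair x -> ~ unbounded (fun n => Down x n 0) ->
  (forall M : int, exists N : nat, forall n, (N <= n)%N -> M <= x n) \/
  (forall M : int, exists N : nat, forall n, (N <= n)%N -> x n <= M).
Proof.
move=> hf hd.
have nio y : exists N : nat, forall n, (N <= n)%N -> x n != y.
  apply: contrapT => hN.
  have hy : infinitely_often x y.
    move=> N; apply: contrapT => hn; apply: hN; exists N => n Nn.
    by apply/eqP => xn; apply: hn; exists n.
  by have [_] := hf.2 _ (fair_io x y 0 hf hy).
have step n : x n.+1 = x n + 1 \/ x n.+1 = x n - 1.
  by have [b] := (hf.1 n.+1).2 n (ltnSn n); case: b; [left|right].
have [N0 hN0] := nio 0.
have [pos|neg] := ltP 0 (x N0); [left|right] => M.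
  have xpos n : (N0 <= n)%N -> 0 < x n.
    elim: n => [|n IH]; first by rewrite leqn0 => /eqP e; rewrite -e.
    rewrite leq_eqVlt => /orP[/eqP <-//|]; rewrite ltnS => hn.
    have := hN0 n.+1 (leqW hn); have := IH hn; case: (step n) => ->; lia.
  have [m0|m0] := leP M 0; first by exists N0 => n /xpos; lia.
  have {m0} [m ->] : exists m : nat, M = m%:Z by exists `|M|%N; lia.
  elim: m => [|m [N hN]]; first by exists N0 => n /xpos; lia.
  have [N' hN'] := nio m%:Z; exists (maxn N N') => n.
  by rewrite geq_max => /andP[/hN h1 /hN' h2]; lia.
have xneg n : (N0 <= n)%N -> x n < 0.
  elim: n => [|n IH].
    rewrite leqn0 => /eqP e; rewrite -e; have := hN0 N0 (leqnn _); lia.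
  rewrite leq_eqVlt => /orP[/eqP <-|].
    have := hN0 N0 (leqnn _); lia.
  rewrite ltnS => hn.
  have := hN0 n.+1 (leqW hn); have := IH hn; case: (step n) => ->; lia.
have [m0|m0] := leP 0 M; first by exists N0 => n /xneg; lia.
have {m0} [m ->] : exists m : nat, M = - m%:Z by exists `|M|%N; lia.
elim: m => [|m [N hN]]; first by exists N0 => n /xneg; lia.
have [N' hN'] := nio (- m%:Z); exists (maxn N N') => n.
by rewrite geq_max => /andP[/hN h1 /hN' h2]; lia.
Qed.

End Paths.

(** * Almost sure behaviour *)

Section WalkLaw.
Context {R : realType} (l : R) (l0 : 0 < l).
Context {d : measure_display} {T : measurableType d} (P : probability T R).
Variable X : nat -> T -> int.
Hypothesis hX : is_GRRW P (@fR R) (fun=> (2^-1, l)) X.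

Definition cyl (x : nat -> int) (n : nat) : set T :=
  [set t | forall k, (k <= n)%N -> X k t = x k].

Definition traj (t : T) (n : nat) : int := X n t.

Definition pathP : (nat -> int) -> nat -> R := path_prob (@fR R) (fun=> (2^-1, l)).

Lemma measurable_cyl x n : measurable (cyl x n).
Proof. exact: (hX n x).1. Qed.

Lemma P_cyl x n : P (cyl x n) = (pathP x n)%:E.
Proof. exact: (hX n x).2. Qed.

Lemma pathP_ge0 x n : 0 <= pathP x n.
Proof. by rewrite -lee_fin -P_cyl. Qed.

Lemma path_prob_ext (f : R -> R) w0 x x' n : (forall k, (k <= n)%N -> x k = x' k) ->
  path_prob f w0 x n = path_prob f w0 x' n.
Proof.
move=> h; rewrite /path_prob h//; case: ifP => // _; apply: eq_bigr => k _.
have hk : x k = x' k by apply: h; exact: ltnW.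
have hk1 : x k.+1 = x' k.+1 by exact: h.
rewrite /step_prob hk hk1 /alpha_tilde.
have hj (j : 'I_k) : x j = x' j by apply: h; exact: ltnW (ltn_trans (ltn_ord j) (ltn_ord k)).
have hj1 (j : 'I_k) : x j.+1 = x' j.+1 by apply: h; exact: leq_trans (ltn_ord j) (ltnW (ltn_ord k)).
have -> : Up x k (x' k) = Up x' k (x' k) by apply: eq_bigr => j _; rewrite hj hj1.
by have -> : Loc x k (x' k) = Loc x' k (x' k) by apply: eq_bigr => j _; rewrite hj.
Qed.

Lemma pathPS x n (b : bool) : nearest_neighbor x n ->
  x n.+1 = (if b then x n + 1 else x n - 1) ->
  pathP x n.+1 = pathP x n *
    (if b then up_prob (urn l) (path_state x n) else 1 - up_prob (urn l) (path_state x n)).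
Proof.
move=> hn hx; rewrite /pathP /path_prob hn.1 eqxx big_ord_recr /=; congr (_ * _).
have e : fR (alpha_tilde (fun=> (2^-1, l)) x n (x n)) = up_prob (urn l) (path_state x n).
  by rewrite /alpha_tilde /up_prob /urn /path_state /= LocE.
rewrite /step_prob e hx; case: b hx => _; first by rewrite eqxx.
have -> : (x n - 1 == x n + 1) = false by apply/negbTE; lia.
by rewrite eqxx.
Qed.

Definition extend (x : nat -> int) (n : nat) (z : int) (k : nat) : int :=
  if (k <= n)%N then x k else z.

Lemma extendE x n z k : (k <= n)%N -> extend x n z k = x k.
Proof. by rewrite /extend => ->. Qed.

Lemma extendS x n z : extend x n z n.+1 = z.
Proof. by rewrite /extend ltnn. Qed.

Lemma cyl_extend x n z t : cyl (extend x n z) n.+1 t <-> cyl x n t /\ X n.+1 t = z.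
Proof.
split=> [h|[h e] k].
  split=> [k kn|]; last by rewrite h// extendS.
  by rewrite h ?extendE//; exact: leqW.
rewrite leq_eqVlt => /orP[/eqP ->|]; first by rewrite extendS.
by rewrite ltnS => kn; rewrite extendE// h.
Qed.

Lemma nearest_neighbor_extend x n (b : bool) : nearest_neighbor x n ->
  nearest_neighbor (extend x n (if b then x n + 1 else x n - 1)) n.+1.
Proof.
move=> [x00 hs]; split; first by rewrite extendE.
move=> k; rewrite ltnS leq_eqVlt => /orP[/eqP ->|kn].
  by exists b; rewrite extendS extendE.
by have [b' hb] := hs k kn; exists b'; rewrite !extendE// ltnW.
Qed.

Lemma up_prob_extend x n (b : bool) : nearest_neighbor x n ->
  let x' := extend x n (if b then x n + 1 else x n - 1) in
  pathP x' n.+1 = pathP x n *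
    (if b then up_prob (urn l) (path_state x n) else 1 - up_prob (urn l) (path_state x n)) /\
  path_state x' n.+1 = step (path_state x n) b.
Proof.
move=> hn x'.
have hx k : (k <= n)%N -> x' k = x k by exact: extendE.
have hS : x' n.+1 = (if b then x' n + 1 else x' n - 1) by rewrite /x' extendS extendE.
have hn' : nearest_neighbor x' n.
  by apply: nearest_neighbor_ext hn => k kn; rewrite hx.
split; last by rewrite (path_stateS _ _ _ hS) (path_state_ext x' x).
by rewrite (pathPS _ _ b)// (path_state_ext x' x)// /pathP (path_prob_ext _ _ x' x).
Qed.

(** Induction on the remaining time. The probabilities of the two one-step extensions add up to that
    of the cylinder, so its other continuations form a null set. *)
Lemma walk_bound_from n m x (B : set T) (Phi : state -> R) :
  measurable B -> (forall S, 0 <= Phi S) -> nearest_neighbor x m ->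
  (forall t, B t -> nearest_neighbor (traj t) (m + n) ->
     1 <= Phi (path_state (traj t) (m + n))) ->
  (P (B `&` cyl x m) <= (pathP x m * walkE (urn l) n Phi (path_state x m))%:E)%E.
Proof.
move=> mB Phi0; elim: n m x => [|n IH] m x hx hB.
  rewrite /=; have [[t [Bt ct]]|ne] := pselect (exists t, (B `&` cyl x m) t).
    have agree k : (k <= m)%N -> x k = traj t k by move=> km; rewrite /traj ct.
    have ht : nearest_neighbor (traj t) m by exact: nearest_neighbor_ext hx.
    have := hB t Bt; rewrite addn0 => /(_ ht) h.
    apply: (@le_trans _ _ (P (cyl x m))).
      apply: le_measure; rewrite ?inE; [|exact: measurable_cyl|exact: subIsetr].
      by apply: measurableI => //; exact: measurable_cyl.
    by rewrite P_cyl lee_fin ler_peMr ?pathP_ge0// (path_state_ext _ _ _ agree).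
  have -> : B `&` cyl x m = set0 by apply/seteqP; split => // t ht; case: ne; exists t.
  by rewrite measure0 lee_fin mulr_ge0// pathP_ge0.
pose xb b := extend x m (if b then x m + 1 else x m - 1).
have hb b : pathP (xb b) m.+1 = pathP x m *
    (if b then up_prob (urn l) (path_state x m) else 1 - up_prob (urn l) (path_state x m)) /\
    path_state (xb b) m.+1 = step (path_state x m) b by exact: up_prob_extend.
have sub b : cyl (xb b) m.+1 `<=` cyl x m by move=> t /cyl_extend[].
pose E := cyl (xb true) m.+1 `|` cyl (xb false) m.+1.
have mE : measurable E by apply: measurableU; exact: measurable_cyl.
have PE : P E = P (cyl x m).
  have -> : P E = (P (cyl (xb true) m.+1) + P (cyl (xb false) m.+1))%E.
    apply: measureU; [exact: measurable_cyl..|].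
    apply/seteqP; split => // t [/cyl_extend[_ e1] /cyl_extend[_]].
    by rewrite e1; lia.
  by rewrite !P_cyl (hb true).1 (hb false).1 -EFinD; congr (_%:E); ring.
have PD : P (cyl x m `\` E) = 0%E.
  have fin : (P (cyl x m) < +oo)%E by rewrite P_cyl ltry.
  have -> : P (cyl x m `\` E) = (P (cyl x m) - P (cyl x m `&` E))%E.
    by apply: measureD => //; exact: measurable_cyl.
  rewrite setIidr; last by move=> t [] /sub.
  by rewrite PE subee// P_cyl.
have cov : B `&` cyl x m `<=`
    ((B `&` cyl (xb true) m.+1) `|` (B `&` cyl (xb false) m.+1)) `|` (cyl x m `\` E).
  move=> t [Bt ct]; have [Et|Et] := pselect (E t); last by right.
  by left; case: Et => h; [left|right].
have mBc b : measurable (B `&` cyl (xb b) m.+1).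
  by apply: measurableI => //; exact: measurable_cyl.
have mD : measurable (cyl x m `\` E) by apply: measurableD => //; exact: measurable_cyl.
have IHb b : (P (B `&` cyl (xb b) m.+1) <=
    (pathP (xb b) m.+1 * walkE (urn l) n Phi (step (path_state x m) b))%:E)%E.
  rewrite -(hb b).2; apply: IH; first exact: nearest_neighbor_extend.
  by move=> t Bt; rewrite addSnnS; exact: hB.
set A1 := B `&` cyl (xb true) m.+1 in cov *; set A2 := B `&` cyl (xb false) m.+1 in cov *.
have mA12 : measurable (A1 `|` A2) by apply: measurableU; exact: mBc.
have h1 : (P (B `&` cyl x m) <= P ((A1 `|` A2) `|` (cyl x m `\` E)))%E.
  have mBC : measurable (B `&` cyl x m).
    by apply: measurableI => //; exact: measurable_cyl.
  have mU : measurable ((A1 `|` A2) `|` (cyl x m `\` E)) by exact: measurableU.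
  by apply: le_measure cov; rewrite inE.
have h2 : (P ((A1 `|` A2) `|` (cyl x m `\` E)) <= P (A1 `|` A2) + P (cyl x m `\` E))%E.
  exact: measureU2.
have h3 : (P (A1 `|` A2) <= P A1 + P A2)%E by apply: measureU2; exact: mBc.
apply: le_trans h1 (le_trans h2 _); rewrite PD adde0; apply: le_trans h3 _.
apply: le_trans (leeD (IHb true) (IHb false)) _.
rewrite (hb true).1 (hb false).1 -EFinD lee_fin /= /stepE; lra.
Qed.

Lemma walk_bound n (B : set T) (Phi : state -> R) : measurable B ->
  (forall S, 0 <= Phi S) ->
  (forall t, B t -> nearest_neighbor (traj t) n -> 1 <= Phi (path_state (traj t) n)) ->
  (P B <= (walkE (urn l) n Phi start)%:E)%E.
Proof.
move=> mB Phi0 hB; pose z : nat -> int := fun=> 0.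
have hz : nearest_neighbor z 0 by split.
have Pz : P (cyl z 0) = 1%E by rewrite P_cyl /pathP /path_prob eqxx big_ord0.
have mz : measurable (cyl z 0) by exact: measurable_cyl.
have := walk_bound_from n 0 z B Phi mB Phi0 hz hB.
rewrite (path_state0 z)// /pathP /path_prob eqxx big_ord0 mul1r; apply: le_trans.
apply: (@le_trans _ _ (P (B `&` cyl z 0) + P (~` cyl z 0))%E).
  have mU : measurable ((B `&` cyl z 0) `|` ~` cyl z 0).
    by apply: measurableU; [exact: measurableI|exact: measurableC].
  have h1 : (P B <= P ((B `&` cyl z 0) `|` ~` cyl z 0))%E.
    apply: le_measure; rewrite ?inE//.
    by move=> t Bt; have [h|h] := pselect (cyl z 0 t); [left|right].
  apply: le_trans h1 _.
  by apply: measureU2; [exact: measurableI|exact: measurableC].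
by rewrite probability_setC// Pz subee// adde0.
Qed.

(** * Events determined by finitely many positions *)

Definition depends_upto (n : nat) (Q : (nat -> int) -> Prop) : Prop :=
  forall x x', (forall k, (k <= n)%N -> x k = x' k) -> Q x -> Q x'.

(** Measurability is given for cylinders only; such an event is a union of cylinders over finite
    integer sequences, which are countably many. *)
Lemma measurable_upto n (Q : (nat -> int) -> Prop) : depends_upto n Q ->
  measurable [set t | Q (traj t)].
Proof.
move=> hQ; pose F (s : seq int) : set T :=
  if `[< Q (nth 0 s) >] then cyl (nth 0 s) n else set0.
have -> : [set t | Q (traj t)] = \bigcup_s F s.
  apply/seteqP; split => t /=.
    move=> Qt; pose s := [seq X k t | k <- iota 0 n.+1].
    have hs k : (k <= n)%N -> nth 0 s k = X k t.
      by move=> kn; rewrite (nth_map 0%N) ?size_iota// nth_iota.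
    exists s => //; rewrite /F asboolT.
      by move=> k kn; rewrite hs.
    by apply: hQ Qt => k kn; rewrite hs.
  move=> [s _]; rewrite /F; case: asboolP => // Qs ct.
  by apply: hQ Qs => k kn; rewrite /traj ct.
apply: countable_bigcupT_measurable => // s; rewrite /F.
by case: ifP => _; [exact: measurable_cyl|exact: measurable0].
Qed.

(* Fatou's lemma for events. *)
Lemma negligible_eventually (E : set T) :
  (forall e : R, 0 < e -> exists Q : nat -> (nat -> int) -> Prop,
    [/\ forall n, depends_upto n (Q n),
        forall n, (P [set t | Q n (traj t)] <= e%:E)%E &
        forall t, E t -> exists m, forall n, (m <= n)%N -> Q n (traj t)]) ->
  P.-negligible E.
Proof.
move=> h.
have key (e : R) : 0 < e -> exists F : set T,
    [/\ measurable F, (P F <= e%:E)%E & E `<=` F].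
  move=> e0; have [Q [hQ PQ EQ]] := h e e0.
  pose G m := \bigcap_n (if (m <= n)%N then [set t | Q n (traj t)] else setT).
  have mQ n : measurable [set t | Q n (traj t)] by exact: measurable_upto (hQ n).
  have mG m : measurable (G m).
    by apply: bigcapT_measurable => n; case: ifP.
  have GQ m : G m `<=` [set t | Q m (traj t)].
    by move=> t /(_ m Logic.I); rewrite leqnn.
  exists (\bigcup_m G m); split.
  - exact: bigcupT_measurable.
  - have ndG : {homo G : n m / (n <= m)%N >-> (n <= m)%O}.
      move=> n m nm; apply/subsetPset => t Gt k _; have := Gt k Logic.I.
      by case: (leqP m k) => // mk; rewrite (leq_trans nm mk).
    have cv := @nondecreasing_cvg_mu _ _ _ P _ mG (bigcupT_measurable _ mG) ndG.
    rewrite -(cvg_lim _ cv)//; apply: lime_le; first by apply/cvg_ex; eexists; exact: cv.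
    apply: nearW => m; apply: le_trans (PQ m).
    by apply: le_measure; rewrite ?inE//; exact: GQ.
  - move=> t /EQ[m hm]; exists m => // n _; case: ifP => // mn; exact: hm.
have hn (n : nat) : (0 : R) < n.+1%:R^-1 by rewrite invr_gt0.
pose F n := sval (cid (key _ (hn n))).
have FP n : [/\ measurable (F n), (P (F n) <= (n.+1%:R^-1)%:E)%E & E `<=` F n].
  exact: svalP (cid (key _ (hn n))).
exists (\bigcap_n F n); split.
- by apply: bigcapT_measurable => n; have [] := FP n.
- apply/eqP; rewrite eq_le measure_ge0 andbT; apply/lee_addgt0Pr => e e0.
  rewrite add0e.
  have [n hne] : exists n : nat, n.+1%:R^-1 < e.
    exists (Num.bound e^-1); rewrite invf_plt ?posrE//.
    apply: lt_trans (archi_boundP _) _; first by rewrite invr_ge0 ltW.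
    by rewrite ltr_nat.
  have [mFn PFn _] := FP n.
  apply: (@le_trans _ _ (P (F n))).
    apply: le_measure; rewrite ?inE//.
      by apply: bigcapT_measurable => k; have [] := FP k.
    by move=> t; apply.
  by apply: le_trans PFn _; rewrite lee_fin ltW.
- by move=> t Et n _; have [_ _] := FP n; exact.
Qed.

End WalkLaw.

(** * Recurrence and transience with probability 1 *)

Section AlmostSure.
Context {R : realType} (l : R) (l0 : 0 < l).
Context {d : measure_display} {T : measurableType d} (P : probability T R).
Variable X : nat -> T -> int.
Hypothesis hX : is_GRRW P (@fR R) (fun=> (2^-1, l)) X.

Let q_ge : forall u v, 2^-1 <= urn l u v := urn_ge l.
Let q_le : forall u v, urn l u v <= 7 / 8 := fun u v => urn_le l u v l0.

Lemma measurable_ex (U : countType) (F : U -> T -> Prop) :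
  (forall u, measurable [set t | F u t]) -> measurable [set t | exists u, F u t].
Proof.
move=> h; have -> : [set t | exists u, F u t] = \bigcup_u [set t | F u t].
  by apply/seteqP; split => t /= [u]; [exists u|move=> _; exists u].
by apply: countable_bigcupT_measurable => //; exact: countableP.
Qed.

Lemma measurable_all (U : countType) (F : U -> T -> Prop) :
  (forall u, measurable [set t | F u t]) -> measurable [set t | forall u, F u t].
Proof.
move=> h; have -> : [set t | forall u, F u t] = ~` [set t | exists u, ~ F u t].
  apply/seteqP; split => t /= hF; first by case=> u; apply.
  by move=> u; apply: contrapT => h'; apply: hF; exists u.
apply: measurableC; apply: measurable_ex => u.
exact: (measurableC (h u)).
Qed.

Lemma measurable_recurrent : measurable [set t | recurrent_path (traj X t)].
Proof.
apply: measurable_all => y; apply: measurable_all => N.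
have -> : [set t | exists2 n, (N <= n)%N & traj X t n = y] =
  [set t | exists n, (N <= n)%N /\ traj X t n = y].
  by apply/seteqP; split => t [n]; [move=> h1 h2|move=> [h1 h2]]; exists n.
apply: measurable_ex => n; apply: (measurable_upto l P X hX n (fun x => (N <= n)%N /\ x n = y)).
by move=> x x' h; rewrite h.
Qed.

Lemma measurable_transient : measurable [set t | transient_path (traj X t)].
Proof.
apply: measurableU; apply: measurable_all => M; apply: measurable_ex => N;
  apply: measurable_all => n.
  apply: (measurable_upto l P X hX n (fun x => (N <= n)%N -> M <= x n)).
  by move=> x x' h; rewrite h.
apply: (measurable_upto l P X hX n (fun x => (N <= n)%N -> x n <= M)).
by move=> x x' h; rewrite h.
Qed.

Lemma negligible_ex (U : countType) (F : U -> T -> Prop) :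
  (forall u, P.-negligible [set t | F u t]) -> P.-negligible [set t | exists u, F u t].
Proof.
move=> h; pose G n := if unpickle n is Some u then [set t | F u t] else set0.
apply: (@negligibleS _ _ _ _ (\bigcup_n G n)).
  by move=> t /= [u Fu]; exists (pickle u) => //; rewrite /G pickleK.
apply: negligible_bigcup => n; rewrite /G; case: unpickle => // ; exact: negligible_set0.
Qed.

Lemma probability_eq1 (A : set T) : measurable A -> P.-negligible (~` A) -> P A = 1%E.
Proof.
move=> mA hA; have h : P (~` A) = 0%E by apply/negligibleP => //; exact: measurableC.
by have := probability_setC P (measurableC mA); rewrite setCK h sube0.
Qed.

Lemma path_events (Q : state -> Prop) n :
  depends_upto n (fun x => nearest_neighbor x n /\ Q (path_state x n)).
Proof.
move=> x x' h [h1 h2]; split; first exact: nearest_neighbor_ext h1.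
by rewrite -(path_state_ext _ _ _ h).
Qed.

Lemma path_event_le (Q : state -> Prop) n (Phi : state -> R) (c : R) :
  (forall S, 0 <= Phi S) -> (forall S, early n S -> Q S -> 1 <= Phi S) ->
  walkE (urn l) n Phi start <= c ->
  (P [set t | nearest_neighbor (traj X t) n /\ Q (path_state (traj X t) n)]%classic
     <= c%:E)%E.
Proof.
move=> Phi0 hQ hc.
have mB := measurable_upto l P X hX n _ (path_events Q n).
apply: le_trans (walk_bound l l0 P X hX n _ Phi mB Phi0 _) _; last by rewrite lee_fin.
by move=> t [h1 h2] _; apply: hQ => //; exact: path_state_early.
Qed.

Lemma nearest_neighbor_as :
  P.-negligible [set t | exists n, ~ nearest_neighbor (traj X t) n].
Proof.
apply: negligible_ex => n.
have mB : measurable [set t | ~ nearest_neighbor (traj X t) n].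
  apply: (measurable_upto l P X hX n (fun x => ~ nearest_neighbor x n)).
  by move=> x x' h hx hx'; apply: hx; apply: nearest_neighbor_ext hx' => k kn; rewrite h.
apply/negligibleP => //; apply/eqP; rewrite eq_le measure_ge0 andbT.
(* [walk_bound] tests [Phi] on nearest-neighbour paths only, and the event contains none, so
   [Phi = 0] is admissible. *)
apply: le_trans (walk_bound l l0 P X hX n _ (fun=> 0) mB _ _) _ => //.
rewrite lee_fin; apply: (walkE_superharmT _ q_ge q_le (fun=> 0)) => S.
by rewrite /stepE !mulr0 addr0.
Qed.

Lemma stepE_scale (c : R) Phi S : stepE (urn l) (fun S => c * Phi S) S =
  c * stepE (urn l) Phi S.
Proof. by rewrite /stepE; ring. Qed.

Lemma Loc_le x m n y : (m <= n)%N -> (Loc x m y <= Loc x n y)%N.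
Proof.
apply: (@homo_leq _ (fun n => Loc x n y) (fun a b => (a <= b)%N)) => // [? ? ?|k].
  exact: leq_trans.
by rewrite LocS leq_addr.
Qed.

Lemma Down_le x m n y : (m <= n)%N -> (Down x m y <= Down x n y)%N.
Proof.
apply: (@homo_leq _ (fun n => Down x n y) (fun a b => (a <= b)%N)) => // [? ? ?|k].
  exact: leq_trans.
by rewrite DownS leq_addr.
Qed.

(** After [N] visits with count at most [M] the weight is at least [r ^ N / 2 ^ M], while it starts
    at 1; the event thus has probability at most [2 ^ M / r ^ N]. *)
Lemma rare_steps (y : int) (cnt : state -> nat) (r : R) (M : nat) : 1 < r ->
  cnt start = 0%N ->
  (forall S, stepE (urn l) (fun S => 2^-1 ^+ cnt S * r ^+ ((S.1 y).1 + (S.1 y).2)) S <=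
     2^-1 ^+ cnt S * r ^+ ((S.1 y).1 + (S.1 y).2)) ->
  P.-negligible [set t | [/\ forall n, nearest_neighbor (traj X t) n,
    infinitely_often (traj X t) y & forall n, (cnt (path_state (traj X t) n) <= M)%N]].
Proof.
move=> r1 c0 hsup; apply: (negligible_eventually l P X hX) => e e0.
have r0 : 0 < r by lra.
have ri : 0 <= r^-1 < 1 by rewrite invr_ge0 ltW//= invf_lt1.
have [N hN] := geometric_small r^-1 (2 ^+ M) e ri e0.
pose Q (S : state) := (cnt S <= M)%N /\ (N <= (S.1 y).1 + (S.1 y).2)%N.
exists (fun n x => nearest_neighbor x n /\ Q (path_state x n)); split.
- by move=> n; exact: path_events.
- move=> n; pose Phi (S : state) := (2 ^+ M * r^-1 ^+ N) *
    (2^-1 ^+ cnt S * r ^+ ((S.1 y).1 + (S.1 y).2)).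
  have p20 k : (0 : R) <= 2^-1 ^+ k by apply: exprn_ge0; lra.
  have c00 : 0 <= 2 ^+ M * r^-1 ^+ N by rewrite mulr_ge0// exprn_ge0// invr_ge0 ltW.
  apply: (path_event_le Q n Phi).
  + by move=> S; rewrite mulr_ge0// mulr_ge0// exprn_ge0// ltW.
  + move=> S _ [h1 h2]; rewrite /Phi mulrACA exprVn exprVn.
    apply: mulr_ege1.
      by rewrite ler_pdivlMr ?exprn_gt0// mul1r ler_weXn2l// ler1n.
    by rewrite mulrC ler_pdivlMr ?exprn_gt0// mul1r ler_weXn2l// ltW.
  + apply: le_trans (walkE_superharmT _ q_ge q_le Phi n start _) _.
      by move=> S; rewrite /Phi stepE_scale ler_wpM2l.
    by rewrite /Phi c0 /= !expr0 !mulr1 ltW.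
- move=> t [h1 h2 h3]; have [m hm] := io_Loc _ _ h2 N.
  exists m => n mn; split => //; split => //.
  by rewrite /= -LocE//; apply: leq_trans hm _; exact: Loc_le.
Qed.

Lemma fair_as : P.-negligible [set t | ~ fair (traj X t)].
Proof.
have U y M := rare_steps y (fun S => (S.1 y).1) (4 / 3) M ltac:(lra) erefl
  (up_weight_super _ q_ge y).
have D y M := rare_steps y (fun S => (S.1 y).2) (16 / 15) M ltac:(lra) erefl
  (down_weight_super _ q_le y).
apply: negligibleS (negligibleU nearest_neighbor_as (negligibleU
  (negligible_ex _ _ (fun y : int => negligible_ex _ _ (fun M : nat => U y M)))
  (negligible_ex _ _ (fun y : int => negligible_ex _ _ (fun M : nat => D y M))))).
move=> t /= nf.
have [nn|nn] := pselect (forall n, nearest_neighbor (traj X t) n); last first.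
  by left; apply: contrapT => h; apply: nn => n; apply: contrapT => h'; apply: h; exists n.
right; apply: contrapT => /not_orP[h1 h2]; apply: nf; split => // y hy.
have ub (c : nat -> nat) : ~ (exists M, forall n, (c n <= M)%N) -> unbounded c.
  move=> h M; apply: contrapT => hM; apply: h; exists M => n.
  by rewrite leqNgt; apply/negP => lt; apply: hM; exists n; exact: ltnW.
by split; apply: ub => -[M hM]; [apply: h1|apply: h2]; exists y, M; split.
Qed.

(** Gambler's ruin: the gap starts at [k] and is at least [k + m] at or below [-m], so being there
    without having left [k] has probability at most [k / (k + m)]. *)
Lemma no_left_escape (k : nat) : P.-negligible [set t |
  [/\ forall n, nearest_neighbor (traj X t) n, forall n, traj X t n < k%:Z &
      forall M : int, exists N : nat, forall n, (N <= n)%N -> traj X t n <= M]].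
Proof.
apply: (negligible_eventually l P X hX) => e e0.
pose m := (Num.bound (k%:R / e)).+1.
have hm : k%:R / (k + m)%N%:R <= e.
  rewrite ler_pdivrMr; last by rewrite ltr0n /m addnS.
  rewrite mulrC -ler_pdivrMr//.
  apply: le_trans (ltW (archi_boundP _)) _; first by rewrite divr_ge0// ltW.
  by rewrite ler_nat /m addnS leqW// leq_addl.
pose Q (S : state) := S.1 k%:Z = (0, 0)%N /\ S.2 <= - m%:Z.
exists (fun n x => nearest_neighbor x n /\ Q (path_state x n)); split.
- by move=> n; exact: path_events.
- move=> n; pose Phi (S : state) : R := (k + m)%N%:R^-1 * left_gap k S.
  apply: (path_event_le Q n Phi).
  + by move=> S; rewrite mulr_ge0// left_gap_ge0.
  + move=> S _ [h1 h2]; rewrite /Phi /left_gap h1 eqxx.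
    have -> /= : S.2 < k%:Z by lia.
    rewrite ler_pdivlMl ?mulr1; last by rewrite ltr0n /m addnS.
    by rewrite -[(k + m)%N%:R]/((k + m)%N%:Z%:~R) ler_int; lia.
  + apply: le_trans (walkE_superharmT _ q_ge q_le Phi n start _) _.
      by move=> S; rewrite /Phi stepE_scale ler_wpM2l// left_gap_super.
    rewrite /Phi /left_gap /=; case: ifP => _; last by rewrite mulr0 ltW.
    by rewrite subr0 mulrC.
- move=> t [h1 h2 h3]; have [N hN] := h3 (- m%:Z).
  exists N => n Nn; split => //; split; last exact: hN.
  rewrite /=; congr pair; rewrite /Up /Down big1// => i _;
    by have := h2 i; case: eqP => [->|//]; rewrite ltxx.
Qed.

(** Being at or beyond [k] with at most [M] down-steps at 0 forces the [level] supermartingale up to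
    1, while its initial value is [chainP k M < e]. *)
Lemma right_escape (M : nat) : (forall t, delta (urn l) t 0 0 <= 1) ->
  P.-negligible [set t |
  [/\ forall n, nearest_neighbor (traj X t) n, forall n, (Down (traj X t) n 0 <= M)%N &
      forall M : int, exists N : nat, forall n, (N <= n)%N -> M <= traj X t n]].
Proof.
move=> hd; apply: (negligible_eventually l P X hX) => e e0.
have [k hk] := chain_null _ q_ge q_le hd M e e0.
pose Q (S : state) := k%:Z <= S.2 /\ ((S.1 0).2 <= M)%N.
exists (fun n x => nearest_neighbor x n /\ Q (path_state x n)); split.
- by move=> n; exact: path_events.
- move=> n; pose Phi (S : state) : R := level (urn l) S.1 (upto M) k 0.
  apply: (path_event_le Q n Phi).
  + by move=> S; have /(_ 0%N)/andP[] := level_unit _ q_ge q_le S.1 _ k (@upto_unit R M).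
  + by move=> S [_ _ bal] [h1 h2]; exact: level_final.
  + apply: le_trans (walkE_superharmT _ q_ge q_le Phi n start _) _.
      by move=> S; apply: level_super => //; [exact: upto_unit|exact: upto_noninc].
    by rewrite /Phi level_start ltW.
- move=> t [h1 h2 h3]; have [N hN] := h3 k%:Z.
  by exists N => n Nn; split => //; split; [exact: hN|exact: h2].
Qed.

Lemma down_bounded : (exists t, 1 < delta (urn l) t 0 0) ->
  P.-negligible [set t | (forall n, nearest_neighbor (traj X t) n) /\
    unbounded (fun n => Down (traj X t) n 0)].
Proof.
move=> hd; apply: (negligible_eventually l P X hX) => e e0.
have [M hM] := chain_tight _ q_ge q_le hd e e0.
pose Q (S : state) : Prop := (M < (S.1 0).2)%N.
exists (fun n x => nearest_neighbor x n /\ Q (path_state x n)); split.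
- by move=> n; exact: path_events.
(* Level [n.+1] is out of reach within [n] steps, so [level_sub] applies throughout; tightness makes
   the initial value at most [e] for every [n]. *)
- move=> n; pose Phi (S : state) : R := 1 - level (urn l) S.1 (upto M) n.+1 0.
  have un (S : state) := level_unit _ q_ge q_le S.1 _ n.+1 (@upto_unit R M) 0%N.
  apply: (path_event_le Q n Phi).
  + by move=> S; rewrite subr_ge0; case/andP: (un S).
  + by move=> S _ h; rewrite /Phi level_zero// subr0.
  + apply: le_trans (@walkE_superharm _ _ q_ge q_le n early Phi _ _ n 0%N start _ _) _.
    * by move=> i S b; exact: early_step.
    * move=> i S ni ei.
      have := level_sub _ q_ge q_le S (upto M) n.+1 i (leqW ni) ei (@upto_unit R M).
      by rewrite /stepE /Phi; lra.
    * by [].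
    * exact: early_start.
    by rewrite /Phi level_start; have := hM n.+1; rewrite /chainP; lra.
- move=> t [h1 h2]; have [N hN] := h2 M.+1.
  exists N => n Nn; split => //; rewrite /Q /=.
  by apply: leq_trans hN _; exact: Down_le.
Qed.

Lemma recurrent_as : (forall t, delta (urn l) t 0 0 <= 1) ->
  P [set t | recurrent_path (fun n => X n t)] = 1%E.
Proof.
move=> hd; apply: probability_eq1; first exact: measurable_recurrent.
apply: negligibleS (negligibleU fair_as (negligibleU
  (negligible_ex _ _ (fun k : nat => no_left_escape k))
  (negligible_ex _ _ (fun M : nat => right_escape M hd)))).
move=> t /= nr; have [hf|] := pselect (fair (traj X t)); last by left.
have nn := hf.1.
have [hu|hb] := pselect (unbounded (fun n => Down (traj X t) n 0)).
  by case: nr; exact: fair_recurrent.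
right; have [right|left] := fair_dichotomy _ hf hb; [right|left]; last first.
  have [N hN] := left 0.
  (* A path escaping to the left is bounded above, as [no_left_escape] requires. *)
  have [k hk] : exists k : nat, forall n, (n < N)%N -> traj X t n < k%:Z.
    elim: N {hN} => [|N [k hk]]; first by exists 0%N.
    exists (maxn k (`|traj X t N|%N.+1)) => n; rewrite ltnS leq_eqVlt => /orP[/eqP ->|].
      by lia.
    by move=> /hk; lia.
  exists k.+1; split => // n; have [/hk|/hN] := ltnP n N; lia.
have [M hM] : exists M, forall n, (Down (traj X t) n 0 <= M)%N.
  apply: contrapT => h; apply: hb => M; apply: contrapT => hM; apply: h; exists M => n.
  by rewrite leqNgt; apply/negP => lt; apply: hM; exists n; exact: ltnW.
by exists M.
Qed.

Lemma transient_as : (exists t, 1 < delta (urn l) t 0 0) ->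
  P [set t | transient_path (fun n => X n t)] = 1%E.
Proof.
move=> hd; apply: probability_eq1; first exact: measurable_transient.
apply: negligibleS (negligibleU fair_as (down_bounded hd)).
move=> t /= nr; have [hf|] := pselect (fair (traj X t)); last by left.
right; split; first exact: hf.1.
by apply: contrapT => hb; apply: nr; exact: fair_dichotomy.
Qed.

End AlmostSure.

Theorem theorem3 (R : realType) :
  exists f : R -> R,
    [/\ is_C3 f,
        (forall x : R, in01 x -> 0 < f x < 1),
        isolated_fixed_points f,
        (forall x : R, in01 x -> 2^-1 <= f x) &
        (stable_fixed_point f (2^-1) /\
         forall p : R, stable_fixed_point f p -> p = 2^-1)] /\
    exists2 l1 : R, 0 < l1 &
      forall l : R, 0 < l ->
        (l1 <= l ->
           forall (d : measure_display) (T : measurableType d)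
                  (P : probability T R) (X : nat -> T -> int),
             is_GRRW P f (fun _ => (2^-1, l)) X ->
             P [set t | recurrent_path (fun n => X n t)] = 1%E) /\
        (l < l1 ->
           forall (d : measure_display) (T : measurableType d)
                  (P : probability T R) (X : nat -> T -> int),
             is_GRRW P f (fun _ => (2^-1, l)) X ->
             P [set t | transient_path (fun n => X n t)] = 1%E).
Proof.
exists (@fR R); split; first exact: fR_spec.
have [l1 l10 hl1] := @drift_threshold R.
exists l1 => // l l0; have [hrec htr] := hl1 l l0; split => hl d T P X hX.
  by apply: recurrent_as hX _ => //; exact: hrec.
by apply: transient_as hX _ => //; exact: htr.
Qed.
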